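(* Assume (A1)–(A4). For every comparator sequence $\mathbf{u}_1,\dots,\mathbf{u}_T\in\mathcal{K}$ with path-length $P_T$, POLA guarantees $$\sum_{t=1}^Tf_t(\mathbf{x}_t)-\sum_{t=1}^Tf_t(\mathbf{u}_t)\le\mathcal{O}\big(T^{3/4}(1+P_T)^{1/4}\big),$$ with constants depending only on $D$ and $G$.
   Context: Online convex optimization: for rounds $t=1,\dots,T$ a learner chooses $\mathbf{x}_t\in\mathcal{K}$, then a loss $f_t:\mathcal{K}\to\mathbb{R}$ is revealed (chosen adversarially), the learner suffers $f_t(\mathbf{x}_t)$ and can access $f_t$. Standing assumptions: (A1) $\mathcal{K}\subseteq\mathbb{R}^d$ is convex and compact, contains $\mathbf{0}$, and $\mathcal{K}\subseteq R\mathcal{B}$ where $R\mathcal{B}$ is the closed Euclidean ball of radius $R$ centered at $\mathbf{0}$; set $D=2R$, so $\|\mathbf{x}-\mathbf{x}'\|_2\le D$ for all $\mathbf{x},\mathbf{x}'\in\mathcal{K}$. (A2) Each $f_t$ is $G$-Lipschitz on $\mathcal{K}$, and its (sub)gradients satisfy $\|\nabla f_t(\mathbf{x})\|_2\le G$. (A3) Each $f_t$ is convex on $\mathcal{K}$: $f_t(\mathbf{y})\ge f_t(\mathbf{x})+\nabla f_t(\mathbf{x})^\top(\mathbf{y}-\mathbf{x})$. (A4) $0\le f_t(\mathbf{x})\le1$ for all $\mathbf{x}\in\mathcal{K}$ and all $t$. Path-length: $P_T=\sum_{t=2}^T\|\mathbf{u}_{t-1}-\mathbf{u}_t\|_2$.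 Infeasible projection oracle $\mathcal{O}_{\mathrm{IP}}(\mathcal{K},\epsilon,\mathbf{x}_0,\mathbf{y}_0)$: given $\epsilon>0$, $\mathbf{x}_0\in\mathcal{K}$, $\mathbf{y}_0\in\mathbb{R}^d$, returns $(\mathbf{x},\tilde{\mathbf{y}})\in\mathcal{K}\times R\mathcal{B}$ with $\|\mathbf{x}-\tilde{\mathbf{y}}\|_2\le\sqrt{3\epsilon}$ and $\|\tilde{\mathbf{y}}-\mathbf{z}\|_2\le\|\mathbf{y}_0-\mathbf{z}\|_2$ for all $\mathbf{z}\in\mathcal{K}$. Algorithm $\mathrm{BOGD}_{\mathrm{IP}}$ (step size $\eta$, block size $K$, tolerance $\epsilon$): pick $\mathbf{x}_1\in\mathcal{K}$ arbitrary, $\tilde{\mathbf{y}}_1=\mathbf{x}_1$. Rounds are split into blocks; block $m$ consists of rounds $(m-1)K+1,\dots,mK$. At every round $t$ of block $m$ the algorithm plays $\mathbf{x}_t=\mathbf{x}_m$. At the last round of block $m$ it sets $\mathbf{y}_{m+1}=\tilde{\mathbf{y}}_m-\eta\sum_{r=(m-1)K+1}^{mK}\nabla f_r(\mathbf{x}_m)$ and $(\mathbf{x}_{m+1},\tilde{\mathbf{y}}_{m+1})=\mathcal{O}_{\mathrm{IP}}(\mathcal{K},\epsilon,\mathbf{x}_m,\mathbf{y}_{m+1})$. Unless stated otherwise, it is run with $K=\eta^{-2/3}$ and $\epsilon=\eta^{2/3}$ (block sizes assumed integral). Geometric covering (GC) intervals: $\mathcal{I}=\bigcup_{k\ge0}\mathcal{I}_k$,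 $\mathcal{I}_k=\{[i\cdot2^k,(i+1)\cdot2^k-1]: i\in\{1,2,\dots\}\}$ (intervals of integers). Algorithm POLA: $\Phi(R,C)=\exp([R]_+^2/(3C))$ with $[x]_+=\max(0,x)$ and $\Phi(0,0)=1$; $w(R,C)=\frac12(\Phi(R+1,C+1)-\Phi(R-1,C+1))$. At each round $t$, for every $I\in\mathcal{I}$ whose first round is $t$, create expert $E_I$: an instance of $\mathrm{BOGD}_{\mathrm{IP}}$ started at round $t$ from an arbitrary point with step size $\eta=|I|^{-3/4}$, run on the rounds of $I$ only; set $R_{t-1,I}=C_{t-1,I}=0$. The active set $\mathcal{A}_t$ consists of the experts $E_I$ with $t\in I$. Each $E_I\in\mathcal{A}_t$ outputs $\mathbf{x}_{t,I}\in\mathcal{K}$; set $w_{t,I}=w(R_{t-1,I},C_{t-1,I})/\sum_{E_{I'}\in\mathcal{A}_t}w(R_{t-1,I'},C_{t-1,I'})$ and play $\mathbf{x}_t=\sum_{E_I\in\mathcal{A}_t}w_{t,I}\mathbf{x}_{t,I}$. After $f_t$ is revealed, for each $E_I\in\mathcal{A}_t$ set $R_{t,I}=R_{t-1,I}+f_t(\mathbf{x}_t)-f_t(\mathbf{x}_{t,I})$, $C_{t,I}=C_{t-1,I}+|f_t(\mathbf{x}_t)-f_t(\mathbf{x}_{t,I})|$, and pass $f_t$ to $E_I$. *)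

(* Defs.v *)
From HB Require Import structures.
From mathcomp Require Import all_boot all_order all_algebra.
From mathcomp Require Import all_classical all_reals all_analysis.
Set Implicit Arguments. Unset Strict Implicit. Unset Printing Implicit Defensive.
Import Order.TTheory GRing.Theory Num.Theory.
Import numFieldNormedType.Exports.
Local Open Scope classical_set_scope.
Local Open Scope ring_scope.

Section POLA.
Variables (R : realType) (d : nat).
Notation vec := 'rV[R]_d.

Definition dotp (a b : vec) : R := \sum_(i < d) a 0 i * b 0 i.
Definition enorm (v : vec) : R := Num.sqrt (dotp v v).

Definition convex_set (K : set vec) : Prop :=
  forall x y (l : R), K x -> K y -> 0 <= l <= 1 -> K (l *: x + (1 - l) *: y).
Definition A1 (K : set vec) (Rad : R) : Prop :=
  [/\ convex_set K, compact K, K 0 & forall x, K x -> enorm x <= Rad].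

Definition A2_A4 (K : set vec) (G : R) (f : nat -> vec -> R) (g : nat -> vec -> vec) : Prop :=
  forall t, [/\ forall x y, K x -> K y -> `|f t x - f t y| <= G * enorm (x - y),
             forall x, K x -> enorm (g t x) <= G,
             forall x y, K x -> K y -> f t x + dotp (g t x) (y - x) <= f t y
           & forall x, K x -> 0 <= f t x <= 1].

(* Infeasible projection oracle specification.  The oracle may depend on the
   calling expert (i,k) and block number m (so it need not be a fixed function
   of its arguments). *)
Definition oracle_type := nat -> nat -> nat -> R -> vec -> vec -> vec * vec.
Definition IP_oracle (K : set vec) (Rad : R) (O : oracle_type) : Prop :=
  forall i k m eps x0 y0, 0 < eps -> K x0 ->
    let: (x, yt) := O i k m eps x0 y0 in
    [/\ K x, enorm yt <= Rad, enorm (x - yt) <= Num.sqrt (3 * eps)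
      & forall z, K z -> enorm (yt - z) <= enorm (y0 - z)].

(* BOGD_IP run on rounds s, s+1, ..., with step eta, block size Kb, tolerance
   eps, started at x1 : state after m complete blocks = (x_{m+1}, y~_{m+1}). *)
Fixpoint bogd_state (O : nat -> R -> vec -> vec -> vec * vec) (g : nat -> vec -> vec)
   (s : nat) (eta : R) (Kb : nat) (eps : R) (x1 : vec) (m : nat) : vec * vec :=
  match m with
  | 0 => (x1, x1)
  | m'.+1 =>
      let: (x, yt) := bogd_state O g s eta Kb eps x1 m' in
      O m' eps x (yt - eta *: \sum_(j < Kb) g (s + m' * Kb + j)%N x)
  end.

Definition bogd_pred O g s eta Kb eps x1 (t : nat) : vec :=
  (bogd_state O g s eta Kb eps x1 ((t - s) %/ Kb)).1.

Definition eta_of (n : nat) : R := (n%:R) `^ (- (3 / 4)).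
Definition blk_of (n : nat) : nat := Num.truncn (eta_of n `^ (- (2 / 3))).
Definition eps_of (n : nat) : R := eta_of n `^ (2 / 3).

(* GC interval of level k containing round t >= 1: [i 2^k, (i+1) 2^k - 1] with
   i = t %/ 2^k (active iff i >= 1, i.e. 2^k <= t). *)
Definition gc_start (t k : nat) : nat := (t %/ 2 ^ k * 2 ^ k)%N.

Definition expert_pred (O : oracle_type) (g : nat -> vec -> vec)
   (init : nat -> nat -> vec) (t k : nat) : vec :=
  let i := (t %/ 2 ^ k)%N in
  let n := (2 ^ k)%N in
  bogd_pred (O i k) g (gc_start t k) (eta_of n) (blk_of n) (eps_of n) (init i k) t.

Definition Phi (r c : R) : R := expR (Num.max 0 r ^+ 2 / (3 * c)).
Definition wgt (r c : R) : R := (Phi (r + 1) (c + 1) - Phi (r - 1) (c + 1)) / 2.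

(* Experts active at round t are indexed by their level k, 2^k <= t. *)
Definition active (t k : nat) : bool := (2 ^ k <= t)%N.

(* (R_{t-1,I}, C_{t-1,I}) for the level-k expert active at t, given the map
   Q k = (R_{t-1,I'}, C_{t-1,I'}) of level-k experts active at t-1. *)
Definition prevRC (Q : nat -> R * R) (t k : nat) : R * R :=
  if (2 ^ k %| t)%N then (0, 0) else Q k.

Definition play_from O g init (P : nat -> R * R) (t : nat) : vec :=
  let Z := \sum_(k < t.+1 | active t k) wgt (P k).1 (P k).2 in
  \sum_(k < t.+1 | active t k) (wgt (P k).1 (P k).2 / Z) *: expert_pred O g init t k.

(* RC t k = (R_{t,I}, C_{t,I}) for the level-k expert active at round t. *)
Fixpoint RC O g init (f : nat -> vec -> R) (t : nat) : nat -> R * R :=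
  match t with
  | 0 => fun _ => (0, 0)
  | t'.+1 =>
      let P := prevRC (RC O g init f t') t'.+1 in
      let x := play_from O g init P t'.+1 in
      fun k => ((P k).1 + (f t'.+1 x - f t'.+1 (expert_pred O g init t'.+1 k)),
                (P k).2 + `|f t'.+1 x - f t'.+1 (expert_pred O g init t'.+1 k)|)
  end.

Definition pola_play O g init f (t : nat) : vec :=
  play_from O g init (prevRC (RC O g init f t.-1) t) t.

Definition path_length (u : nat -> vec) (T : nat) : R :=
  \sum_(2 <= t < T.+1) enorm (u t.-1 - u t).

End POLA.

(* Main.v *)
Require Import Defs.
From HB Require Import structures.
From mathcomp Require Import all_boot all_order all_algebra.
From mathcomp Require Import all_classical all_reals all_analysis.
From mathcomp Require Import ring lra.
Import Order.TTheory GRing.Theory Num.Theory.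
Local Open Scope classical_set_scope.
Local Open Scope ring_scope.

(* Write [q = |I|^(1/4)].  An expert with step [q^-3] on an interval of length
   [q^4] has regret [O(q^3)] times one plus the path length of the comparator
   inside the interval.  For the aggregation, the total potential [Phi] of the
   active experts grows by [O(1)] per round, and an expert carries its potential
   away when it ends; so the final potentials of all experts of a level sum to
   [O(T)].  As [Phi - 1] dominates [R^4 / C^2], Young's inequality bounds the
   summed regret against the experts of that level by [O(T / q)], without the
   factor [log T] that a bound for each interval separately would cost.  Rounds
   before the first interval of the level are covered by the dyadic intervals
   from [2^j] to [2^(j+1) - 1], and the choice [q^4 ~ T / (1 + P_T)] balances the terms
   [T / q] and [q^3 (1 + P_T)]. *)

(** * Inner product, norm and convex combinations in Euclidean space *)

Section Euclid.
Context {R : realType} {d : nat}.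
Implicit Types a b c x y : 'rV[R]_d.

Lemma dotpC a b : dotp a b = dotp b a.
Proof. by apply: eq_bigr => i _; rewrite mulrC. Qed.

Lemma dotpDl a b c : dotp (a + b) c = dotp a c + dotp b c.
Proof. by rewrite -big_split; apply: eq_bigr => i _; rewrite mxE mulrDl. Qed.

Lemma dotpZl (l : R) a b : dotp (l *: a) b = l * dotp a b.
Proof. by rewrite /dotp mulr_sumr; apply: eq_bigr => i _; rewrite mxE mulrA. Qed.

Lemma dotpNl a b : dotp (- a) b = - dotp a b.
Proof. by rewrite -scaleN1r dotpZl mulN1r. Qed.

Lemma dotpDr a b c : dotp c (a + b) = dotp c a + dotp c b.
Proof. by rewrite dotpC dotpDl !(dotpC c). Qed.

Lemma dotpZr (l : R) a b : dotp a (l *: b) = l * dotp a b.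
Proof. by rewrite dotpC dotpZl dotpC. Qed.

Lemma dotpNr a b : dotp a (- b) = - dotp a b.
Proof. by rewrite dotpC dotpNl dotpC. Qed.

Lemma dotp0l a : dotp 0 a = 0.
Proof. by rewrite -(scale0r 0) dotpZl mul0r. Qed.

Lemma dotp0r a : dotp a 0 = 0.
Proof. by rewrite dotpC dotp0l. Qed.

Definition dotpE := (dotpDl, dotpDr, dotpNl, dotpNr, dotpZl, dotpZr).

Lemma dotp_sumr (I : Type) (s : seq I) (P : pred I) (F : I -> 'rV[R]_d) a :
  dotp a (\sum_(i <- s | P i) F i) = \sum_(i <- s | P i) dotp a (F i).
Proof. by elim/big_rec2: _ => [|i x y _ <-]; rewrite ?dotp0r ?dotpDr. Qed.

Lemma dotp_suml (I : Type) (s : seq I) (P : pred I) (F : I -> 'rV[R]_d) a :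
  dotp (\sum_(i <- s | P i) F i) a = \sum_(i <- s | P i) dotp (F i) a.
Proof. by rewrite dotpC dotp_sumr; apply: eq_bigr => i _; rewrite dotpC. Qed.

Lemma dotp_ge0 a : 0 <= dotp a a.
Proof. by apply: sumr_ge0 => i _; rewrite -expr2 sqr_ge0. Qed.

Lemma enorm_ge0 a : 0 <= enorm a.
Proof. exact: sqrtr_ge0. Qed.

Lemma enorm_sqr a : enorm a ^+ 2 = dotp a a.
Proof. by rewrite sqr_sqrtr ?dotp_ge0. Qed.

Lemma enormN a : enorm (- a) = enorm a.
Proof. by rewrite /enorm dotpNl dotpNr opprK. Qed.

Lemma enorm0 : enorm (0 : 'rV[R]_d) = 0.
Proof. by rewrite /enorm dotp0l sqrtr0. Qed.

Lemma enorm_eq0 a : enorm a = 0 -> a = 0.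
Proof.
move=> /(congr1 (fun l : R => l ^+ 2)); rewrite enorm_sqr expr0n /= => /eqP.
rewrite psumr_eq0 => [/allP h|i _]; last by rewrite -expr2 sqr_ge0.
apply/rowP => i; rewrite mxE.
by have := h i (mem_index_enum _); rewrite -expr2 sqrf_eq0 => /eqP.
Qed.

(** Cauchy-Schwarz: for nonzero norms, the squared length of [enorm b *: a - enorm a *: b] is
    [2 * enorm a * enorm b] times the gap between the two sides. *)
Lemma dotp_le_enorm a b : dotp a b <= enorm a * enorm b.
Proof.
have [/enorm_eq0 ->|na] := eqVneq (enorm a) 0; first by rewrite dotp0l enorm0 mul0r.
have [/enorm_eq0 ->|nb] := eqVneq (enorm b) 0; first by rewrite dotp0r enorm0 mulr0.
have a0 : 0 < enorm a by rewrite lt_def na enorm_ge0.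
have b0 : 0 < enorm b by rewrite lt_def nb enorm_ge0.
have := dotp_ge0 (enorm b *: a - enorm a *: b).
rewrite !dotpE (dotpC b a) -!enorm_sqr => h.
rewrite -subr_ge0 -(pmulr_rge0 _ (mulr_gt0 a0 b0)).
by move: h; nra.
Qed.

Lemma enormD a b : enorm (a + b) <= enorm a + enorm b.
Proof.
rewrite -ler_sqr ?nnegrE ?addr_ge0 ?enorm_ge0// enorm_sqr !dotpE (dotpC b a).
by rewrite -!enorm_sqr; have := dotp_le_enorm a b; nra.
Qed.

Lemma enorm_sqrBZ (l : R) a b :
  enorm (a - l *: b) ^+ 2 = enorm a ^+ 2 - 2 * l * dotp b a + (l * enorm b) ^+ 2.
Proof. by rewrite exprMn !enorm_sqr !dotpE (dotpC a b); ring. Qed.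

Lemma enorm_sum (I : Type) (s : seq I) (P : pred I) (F : I -> 'rV[R]_d) :
  enorm (\sum_(i <- s | P i) F i) <= \sum_(i <- s | P i) enorm (F i).
Proof.
elim/big_rec2: _ => [|i x y _ h]; first by rewrite enorm0.
by apply: le_trans (enormD _ _) _; rewrite lerD2l.
Qed.

Lemma enorm_path_le (u : nat -> 'rV[R]_d) s n :
  enorm (u s - u (s + n)%N) <= \sum_(s <= t < s + n) enorm (u t - u t.+1).
Proof.
elim: n => [|n IH]; first by rewrite addn0 subrr enorm0 big_geq.
rewrite addnS big_nat_recr ?leq_addr//=.
have -> : u s - u (s + n).+1 = u s - u (s + n)%N + (u (s + n)%N - u (s + n).+1).
  by rewrite addrA subrK.
by apply: le_trans (enormD _ _) _; rewrite lerD2r.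
Qed.

(** The weights stay unnormalised, so the induction adds one point at a time by two-point convexity,
    and a zero total weight needs no exclusion. *)
Lemma convex_set_sum (K : set 'rV[R]_d) (I : Type) (s : seq I) (P : pred I)
    (w : I -> R) (F : I -> 'rV[R]_d) :
  Defs.convex_set K -> K 0 -> (forall i, P i -> 0 <= w i) -> (forall i, P i -> K (F i)) ->
  exists2 z, K z & \sum_(i <- s | P i) w i *: F i = (\sum_(i <- s | P i) w i) *: z.
Proof.
move=> cK K0 w0 KF.
suff [] : 0 <= \sum_(i <- s | P i) w i /\
  exists2 z, K z & \sum_(i <- s | P i) w i *: F i = (\sum_(i <- s | P i) w i) *: z by [].
elim/big_rec2: _ => [|i v S Pi [S0 [z Kz ->]]].
  by split=> //; exists 0; rewrite ?scale0r.
have wi0 := w0 i Pi; split; first exact: addr_ge0.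
have [e|ne] := eqVneq (w i + S) 0.
  exists 0 => //; have -> : w i = 0 by lra.
  have -> : S = 0 by lra.
  by rewrite !scale0r scaler0 addr0.
have p : 0 < w i + S by rewrite lt_def ne addr_ge0.
exists (w i / (w i + S) *: F i + (1 - w i / (w i + S)) *: z).
  apply: cK => //; first exact: KF.
  by rewrite divr_ge0 ?(ltW p)//= ler_pdivrMr// mul1r lerDl.
by rewrite scalerDr !scalerA; congr (_ *: _ + _ *: _); field.
Qed.

End Euclid.

(** * Convexity and drift of the potential [Phi] *)

Section Potential.
Context {R : realType}.
Implicit Types a b c l r x y : R.

(** The tangent at the mean [m] lies below [expR]; averaging this at [x] and [y] cancels the linear
    terms. *)
Lemma expR_convex l x y : 0 <= l <= 1 ->
  expR ((1 - l) * x + l * y) <= (1 - l) * expR x + l * expR y.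
Proof.
move=> /andP[l0 l1]; set m := (_ + _).
have h z : expR m * (1 + (z - m)) <= expR z.
  have -> : expR z = expR m * expR (z - m) by rewrite -expRD subrKC.
  by rewrite ler_wpM2l ?expR_ge0 ?expR_ge1Dx.
have := ler_wpM2l l0 (h y); have l1' : 0 <= 1 - l by lra.
by have := ler_wpM2l l1' (h x); rewrite /m; lra.
Qed.

Lemma expR_le1DxexpR x : expR x <= 1 + x * expR x.
Proof.
have := ler_wpM2r (expR_ge0 x) (expR_ge1Dx (- x)).
by rewrite -expRD addNr expR0; lra.
Qed.

Lemma expRB1_ge_sqr x : 0 <= x -> x ^+ 2 / 2 <= expR x - 1.
Proof. by move=> x0; have := expR_ge1Dxn 1 x0; rewrite (_ : 2`!%:R = 2 :> R)//; lra. Qed.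

(** Applying [expR y <= 1 / (1 - y)] at [y = x / 4] and taking fourth powers lowers the second-order
    coefficient from 1 to 5/8, which leaves room below the constant of [cosh_le]. *)
Lemma expR_le_quartic x : `|x| <= 2 / 3 -> expR x * (1 - x / 4) ^+ 4 <= 1.
Proof.
rewrite ler_norml => /andP[x1 x2].
have -> : expR x = (expR (x / 4)) ^+ 4 by rewrite -expRM_natr; congr expR; field.
rewrite -exprMn exprn_ile1 ?mulr_ge0 ?expR_ge0//; first lra.
have := ler_wpM2l (expR_ge0 (x / 4)) (expR_ge1Dx (- (x / 4))).
by rewrite -expRD subrr expR0.
Qed.

(* The constant 7/10 only has to be smaller than 3/4 for the drift of the
   potential to be absorbed by the growth of its second argument. *)
Lemma cosh_le x : `|x| <= 2 / 3 -> (expR x + expR (- x)) / 2 <= 1 + 7 / 10 * x ^+ 2.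
Proof.
move=> hx; have h1 := expR_le_quartic _ hx.
have h2 : expR (- x) * (1 + x / 4) ^+ 4 <= 1.
  by have := expR_le_quartic (- x); rewrite normrN mulNr opprK => /(_ hx).
move: hx; rewrite ler_norml => /andP[x1 x2].
have p1 : 0 < (1 - x / 4) ^+ 4 by rewrite exprn_gt0//; lra.
have p2 : 0 < (1 + x / 4) ^+ 4 by rewrite exprn_gt0//; lra.
rewrite -ler_pdivlMr// mul1r in h1.
rewrite -ler_pdivlMr// mul1r in h2.
apply: le_trans (_ : (((1 - x / 4) ^+ 4)^-1 + ((1 + x / 4) ^+ 4)^-1) / 2 <= _); first lra.
(* The two quartic denominators multiply to [(1 - s) ^+ 4], so a polynomial inequality in [s] on
   [0, 1/36] remains. *)
set s := x ^+ 2 / 16.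
have s0 : 0 <= s by rewrite divr_ge0 ?sqr_ge0.
have s1 : s <= 1 / 36 by rewrite /s; nra.
have -> : 7 / 10 * x ^+ 2 = 56 / 5 * s by rewrite /s; field.
have -> : (((1 - x / 4) ^+ 4)^-1 + ((1 + x / 4) ^+ 4)^-1) / 2
   = (1 + 6 * s + s ^+ 2) / (1 - s) ^+ 4.
  rewrite /s; field; apply/and3P; split; apply/negP => /eqP; nra.
rewrite ler_pdivrMr ?exprn_gt0; [|lra|lra].
have : 1 - 4 * s + 6 * s ^+ 2 - 4 * s ^+ 3 <= (1 - s) ^+ 4.
  have -> : (1 - s) ^+ 4 = 1 - 4 * s + 6 * s ^+ 2 - 4 * s ^+ 3 + s ^+ 4 by ring.
  by rewrite lerDl exprn_ge0.
have : 0 < 1 + 56 / 5 * s by lra.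
move=> h3 h4; apply: le_trans (ler_wpM2l (ltW h3) h4).
have s2 : s ^+ 2 <= s / 36 by nra.
have s3 : s ^+ 3 <= s ^+ 2 / 36 by rewrite exprSr; nra.
have s20 : 0 <= s ^+ 2 by rewrite sqr_ge0.
have s30 : 0 <= s ^+ 3 by rewrite exprn_ge0.
have s4 : s ^+ 4 <= s ^+ 3 / 36 by rewrite exprSr; nra.
have -> : (1 + 56 / 5 * s) * (1 - 4 * s + 6 * s ^+ 2 - 4 * s ^+ 3) =
  1 + (36/5) * s + (6 - 224/5) * s ^+ 2 + (336/5-4) * s ^+ 3 - 224/5 * s ^+ 4 by field.
lra.
Qed.

(** Joint convexity of the quadratic-over-linear function: after clearing the left denominator the
    gap is a multiple of [(a / c - b / e) ^+ 2]. The degenerate case [c = 0] relies on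
    [0 / 0 = 0]. *)
Lemma sqr_div_convex l a b c e : 0 <= l <= 1 -> 0 <= c -> (c = 0 -> a = 0) -> 0 < e ->
  ((1 - l) * a + l * b) ^+ 2 / ((1 - l) * c + l * e) <=
  (1 - l) * (a ^+ 2 / c) + l * (b ^+ 2 / e).
Proof.
move=> /andP[l0 l1] c0 ca e0.
have [c00|cN0] := eqVneq c 0.
  rewrite c00 (ca c00) !mulr0 expr0n mul0r mulr0 !add0r.
  have [->|lN0] := eqVneq l 0; first by rewrite !mul0r expr0n /= mul0r.
  have eN0 : e != 0 by rewrite gt_eqF.
  suff -> : (l * b) ^+ 2 / (l * e) = l * (b ^+ 2 / e) by [].
  by field; rewrite lN0 eN0.
have cp : 0 < c by rewrite lt_def cN0.
have eN0 : e != 0 by rewrite gt_eqF.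
have p : 0 < (1 - l) * c + l * e by have := le_lt_trans l0; nra.
rewrite ler_pdivrMr// -subr_ge0.
have -> : ((1 - l) * (a ^+ 2 / c) + l * (b ^+ 2 / e)) * ((1 - l) * c + l * e) -
   ((1 - l) * a + l * b) ^+ 2 = (1 - l) * l * c * e * (a / c - b / e) ^+ 2.
  by field; rewrite cN0 eN0.
apply: mulr_ge0; last exact: sqr_ge0.
by apply: mulr_ge0 (ltW e0); rewrite mulr_ge0 ?mulr_ge0 ?subr_ge0.
Qed.

(** [Phi] composes the convex positive part, the quadratic-over-linear function, which is monotone
    in a nonnegative numerator, and the increasing convex [expR]. The condition [a <= c] makes the
    positive part vanish when [c = 0]. *)
Lemma Phi_convex l a b c e : 0 <= l <= 1 -> 0 <= c -> a <= c -> 0 < e ->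
  Phi ((1 - l) * a + l * b) ((1 - l) * c + l * e) <= (1 - l) * Phi a c + l * Phi b e.
Proof.
move=> l01 c0 ac e0; apply: le_trans (expR_convex l _ _ l01); rewrite ler_expR.
have [l0 l1] := andP l01.
have hm : Num.max 0 ((1 - l) * a + l * b) <= (1 - l) * Num.max 0 a + l * Num.max 0 b.
  have l1' : 0 <= 1 - l by lra.
  have ha : 0 <= Num.max 0 a by rewrite le_max lexx.
  have hb : 0 <= Num.max 0 b by rewrite le_max lexx.
  have ha' : a <= Num.max 0 a by rewrite le_max lexx orbT.
  have hb' : b <= Num.max 0 b by rewrite le_max lexx orbT.
  by rewrite ge_max; apply/andP; split; [rewrite addr_ge0 ?mulr_ge0|rewrite lerD ?ler_wpM2l].
have := @sqr_div_convex l (Num.max 0 a) (Num.max 0 b) (3 * c) (3 * e) l01.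
rewrite (mulrCA (1 - l)) (mulrCA l 3 e) -mulrDr => h.
apply: le_trans (h _ _ _).
- apply: ler_wpM2r.
    by rewrite invr_ge0 mulr_ge0// addr_ge0// mulr_ge0 ?(ltW e0)// subr_ge0.
  by rewrite lerXn2r// nnegrE ?(le_trans _ hm)// le_max lexx.
- by rewrite mulr_ge0.
- by move=> c00; apply/max_idPl; lra.
- by rewrite mulr_gt0.
Qed.

Lemma Phi_ge1 r c : 0 <= c -> 1 <= Phi r c.
Proof.
by move=> c0; rewrite -expR0 ler_expR divr_ge0 ?sqr_ge0 ?mulr_ge0.
Qed.

Lemma Phi_le_expR r x c : 0 < c -> r <= x -> 0 <= x -> Phi r c <= expR (x ^+ 2 / (3 * c)).
Proof.
move=> c0 rx x0; rewrite ler_expR ler_wpM2r ?invr_ge0 ?mulr_ge0 ?(ltW c0)//.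
by rewrite lerXn2r ?nnegrE// ?le_max ?lexx// ge_max x0.
Qed.

Lemma Phi_np r c : r <= 0 -> Phi r c = 1.
Proof. by move=> r0; rewrite /Phi max_l// expr0n mul0r expR0. Qed.

Lemma wgt_ge0 r c : 0 <= c -> 0 <= wgt r c.
Proof.
move=> c0; rewrite divr_ge0// subr_ge0 ler_expR ler_wpM2r ?invr_ge0 ?mulr_ge0 ?addr_ge0//.
have h : Num.max 0 (r - 1) <= Num.max 0 (r + 1).
  by rewrite ge_max !le_max lexx /=; apply/orP; right; lra.
by rewrite lerXn2r// nnegrE le_max lexx.
Qed.

Lemma wgt00_gt0 : 0 < wgt 0 0 :> R.
Proof.
rewrite divr_gt0// subr_gt0 [ltLHS]Phi_np; last lra.
by rewrite /Phi !add0r max_r// expr1n mulr1 div1r expR_gt1 invr_gt0.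
Qed.

(** For [r > 0] the symmetric step multiplies by a cosh factor, while the larger denominator lowers
    the exponent. If [r ^+ 2 >= 15 * c] the exponent does not grow at all; otherwise it starts below
    5 and its growth costs [O(1 / (c + 1))]. For [r <= 0] the old potential is 1 and the new
    exponent is at most [1 / (3 * (c + 1))]. *)
Lemma Phi_avg r c : 0 <= c -> r <= c ->
  (Phi (r + 1) (c + 1) + Phi (r - 1) (c + 1)) / 2 <= Phi r c + expR 6 / (c + 1).
Proof.
move=> c0 rc; have c1 : 0 < c + 1 by lra.
have i0 : 0 < (c + 1)^-1 by rewrite invr_gt0.
have i1 : (c + 1)^-1 <= 1 by rewrite invf_le1//; lra.
have i3 : (3 * (c + 1))^-1 = (c + 1)^-1 / 3 by rewrite invfM mulrC.
(* The exponent [A + h] is at most 6 because [(c + 1)^-1 <= 1]; this is where [expR 6] comes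
   from. *)
have small A h : A <= 5 -> 0 <= h <= (c + 1)^-1 -> expR (A + h) <= expR A + expR 6 / (c + 1).
  move=> A5 /andP[h0 h1]; rewrite expRD.
  apply: le_trans (ler_wpM2l (expR_ge0 A) (expR_le1DxexpR h)) _.
  rewrite mulrDr mulr1 lerD2l mulrCA -expRD (mulrC (expR 6)).
  by apply: ler_pM => //; rewrite ?expR_ge0// ler_expR; lra.
have [r0|r0] := lerP r 0.
  have rN : r - 1 <= 0 by lra.
  rewrite (Phi_np _ _ r0) (Phi_np _ _ rN).
  have h1 : Phi (r + 1) (c + 1) <= expR (0 + (3 * (c + 1))^-1).
    have r1 : r + 1 <= 1 by lra.
    by have := Phi_le_expR _ _ _ c1 r1 ler01; rewrite expr1n div1r add0r.
  have := small 0 (3 * (c + 1))^-1; rewrite expR0 i3.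
  have := expR_ge0 (6 : R); rewrite i3 in h1.
  move=> h2 /(_ ltac:(lra) ltac:(lra)) h3.
  have : 0 <= expR 6 / (c + 1) by rewrite divr_ge0// ltW.
  by lra.
pose x := 2 * r / (3 * (c + 1)).
pose b := (r ^+ 2 + 1) / (3 * (c + 1)).
have x0 : 0 <= x by rewrite divr_ge0 ?mulr_ge0// ltW.
have x23 : `|x| <= 2 / 3.
  by rewrite ger0_norm// /x ler_pdivrMr ?mulr_gt0//; lra.
have hp : Phi (r + 1) (c + 1) <= expR (b + x).
  have -> : b + x = (r + 1) ^+ 2 / (3 * (c + 1)) by rewrite /b /x -mulrDl; congr (_ / _); ring.
  by apply: Phi_le_expR => //; lra.
have hm : Phi (r - 1) (c + 1) <= expR (b - x).
  have -> : b - x = (r - 1) ^+ 2 / (3 * (c + 1)) by rewrite /b /x -mulrBl; congr (_ / _); ring.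
  rewrite ler_expR ler_wpM2r ?invr_ge0 ?mulr_ge0 ?(ltW c1)//.
  by have [r1|r1] := lerP 0 (r - 1); rewrite ?expr0n ?sqr_ge0.
have h1 : (Phi (r + 1) (c + 1) + Phi (r - 1) (c + 1)) / 2 <= expR (b + 7 / 10 * x ^+ 2).
  rewrite expRD; apply: le_trans (_ : expR b * ((expR x + expR (- x)) / 2) <= _).
    by rewrite mulrA mulrDr -!expRD; lra.
  apply: ler_wpM2l; first exact: expR_ge0.
  exact: le_trans (cosh_le _ x23) (expR_ge1Dx _).
apply: le_trans h1 _.
have cp : 0 < c by lra.
have cN0 : c != 0 by rewrite gt_eqF.
have c1N0 : c + 1 != 0 by rewrite gt_eqF.
have Phir : Phi r c = expR (r ^+ 2 / (3 * c)) by rewrite /Phi max_r// ltW.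
(* The cosh term costs [14/45 * r ^+ 2 / (c + 1) ^+ 2] and the larger denominator gains
   [1/3 * r ^+ 2 / (c * (c + 1))]; the surplus 1/3 - 14/45 = 1/45 is the term with 15. *)
have key : b + 7 / 10 * x ^+ 2 <=
    r ^+ 2 / (3 * c) + (1 - r ^+ 2 / (15 * c)) * (3 * (c + 1))^-1.
  rewrite -subr_ge0.
  have -> : r ^+ 2 / (3 * c) + (1 - r ^+ 2 / (15 * c)) * (3 * (c + 1))^-1
    - (b + 7 / 10 * x ^+ 2) = (14 / 45) * r ^+ 2 / (c * (c + 1) ^+ 2).
    by rewrite /b /x; field; rewrite cN0 c1N0.
  by apply: divr_ge0; apply: mulr_ge0; rewrite ?sqr_ge0//; lra.
have E0 : 0 <= expR 6 / (c + 1) by rewrite divr_ge0 ?expR_ge0// ltW.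
have [h15|h15] := lerP (15 * c) (r ^+ 2).
  rewrite Phir; apply: le_trans (_ : expR (r ^+ 2 / (3 * c)) <= _); last by rewrite lerDl.
  rewrite ler_expR; apply: le_trans key _; rewrite gerDl.
  apply: mulr_le0_ge0; last by rewrite i3; lra.
  by rewrite subr_le0 ler_pdivlMr ?mulr_gt0// mul1r.
rewrite Phir; apply: le_trans (small _ (3 * (c + 1))^-1 _ _); last 2 first.
- by rewrite ler_pdivrMr ?mulr_gt0//; lra.
- by rewrite i3; lra.
rewrite ler_expR; apply: le_trans key _; rewrite lerD2l -[leRHS]mul1r.
by apply: ler_wpM2r; [rewrite i3; lra|rewrite gerBl divr_ge0 ?sqr_ge0 ?mulr_ge0].
Qed.

(* [q |-> Phi (x + q) (c + |q|)] is convex on both halves of [-1, 1], so only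
   the endpoints, where both signs give the average of [Phi_avg], matter. *)
Lemma Phi_step x c r : 0 <= c -> `|x| <= c -> `|r| <= 1 ->
  Phi (x + r) (c + `|r|) <= Phi x c + wgt x c * r + expR 6 * (`|r| / (c + 1)).
Proof.
move=> c0; rewrite ler_norml => /andP[xc' xc] r1; have c1 : 0 < c + 1 by lra.
have avg := Phi_avg x c c0 xc.
have := @Phi_convex `|r| x (if 0 <= r then x + 1 else x - 1) c (c + 1) _ c0 xc c1.
rewrite normr_ge0 r1 => /(_ isT).
have -> : (1 - `|r|) * c + `|r| * (c + 1) = c + `|r| by ring.
have a0 := normr_ge0 r.
move: (ler_wpM2l a0 avg); rewrite /wgt.
case: (ger0P r) => r0 in r1 a0 *.
  have -> : (1 - r) * x + r * (x + 1) = x + r by ring.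
  move: (Phi _ _) (Phi _ _) (Phi _ _) (Phi _ _) => p q s t.
  by rewrite mulrDr [r * (_ / _)]mulrCA; lra.
have -> : (1 - - r) * x + - r * (x - 1) = x + r by ring.
move: (Phi _ _) (Phi _ _) (Phi _ _) (Phi _ _) => p q s t.
by rewrite mulrDr [- r * (_ / _)]mulrCA; lra.
Qed.

(* If [x > q^3] then [x <= x^4 / q^9 <= x^4 / (q c^2)], and [Phi x c - 1]
   dominates [x^4 / (18 c^2)]. *)
Lemma le_Phi_potential x c q : 0 < q -> 0 <= c <= q ^+ 4 -> `|x| <= c ->
  x <= q ^+ 3 + 18 / q * (Phi x c - 1).
Proof.
move=> q0 /andP[c0 cq]; rewrite ler_norml => /andP[xc' xc].
have P0 : 0 <= 18 / q * (Phi x c - 1).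
  by rewrite mulr_ge0 ?divr_ge0 ?(ltW q0)// subr_ge0 Phi_ge1.
have q3 : 0 < q ^+ 3 by rewrite exprn_gt0.
have [xq|qx] := lerP x (q ^+ 3); first lra.
have x0 : 0 < x by lra.
have cp : 0 < c by lra.
apply: le_trans (_ : 18 / q * ((x ^+ 2 / (3 * c)) ^+ 2 / 2) <= _); last first.
  apply: le_trans (_ : 18 / q * (Phi x c - 1) <= _); last lra.
  apply: ler_wpM2l; first by rewrite divr_ge0// ltW.
  rewrite /Phi max_r ?(ltW x0)//; apply: expRB1_ge_sqr.
  by rewrite divr_ge0 ?sqr_ge0 ?mulr_ge0.
have -> : 18 / q * ((x ^+ 2 / (3 * c)) ^+ 2 / 2) = x * (x ^+ 3 / (q * c ^+ 2)).
  by field; rewrite !gt_eqF.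
rewrite -[leLHS]mulr1 ler_pM2l// ler_pdivlMr ?mulr_gt0 ?exprn_gt0// mul1r.
apply: le_trans (_ : q * (q ^+ 4) ^+ 2 <= _).
  by rewrite ler_pM2l// lerXn2r// nnegrE// exprn_ge0// ltW.
rewrite -exprM -exprS (_ : 9 = 3 * 3)%N// exprM.
by rewrite lerXn2r ?nnegrE ?ltW.
Qed.

(** Makes the drift terms telescope: with [a], [b] the two roots, [r = (a - b) * (a + b)] and
    [a + b <= 3 * b <= 3 * b ^+ 2]. Square-root growth suffices, since it gives [O(q ^+ 2)] per
    interval of length [q ^+ 4], which is summable over levels. *)
Lemma div1D_le_sqrt c r : 0 <= c -> 0 <= r <= 1 ->
  r / (c + 1) <= 3 * (Num.sqrt (c + r + 1) - Num.sqrt (c + 1)).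
Proof.
move=> c0 /andP[r0 r1].
set a := Num.sqrt (c + r + 1); set b := Num.sqrt (c + 1).
have a2 : a ^+ 2 = c + r + 1 by rewrite sqr_sqrtr; lra.
have b2 : b ^+ 2 = c + 1 by rewrite sqr_sqrtr; lra.
have b1 : 1 <= b by rewrite -sqrtr1 ler_sqrt; lra.
have ba : b <= a by rewrite ler_sqrt; lra.
have a2b : a <= 2 * b by rewrite -ler_sqr ?nnegrE; [nra|lra|lra].
rewrite -b2 (_ : r = (a - b) * (a + b)); last by rewrite -subr_sqr a2 b2; ring.
have b0 : 0 < b ^+ 2 by rewrite exprn_gt0//; lra.
rewrite ler_pdivrMr//.
have h : a + b <= 3 * b ^+ 2 by nra.
have ab : 0 <= a - b by rewrite subr_ge0.
by have := ler_wpM2l ab h; lra.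
Qed.

End Potential.

(** * Dynamic regret of a single run of [BOGD_IP] *)

Lemma sum_nat_shift (V : nmodType) (F : nat -> V) a n :
  \sum_(a <= t < a + n) F t = \sum_(j < n) F (a + j)%N.
Proof.
rewrite -{1}(add0n a) big_addn addKn big_mkord.
by apply: eq_bigr => i _; rewrite addnC.
Qed.

Section Base.
Context {R : realType} {d : nat}.
Variables (K : set 'rV[R]_d) (Rad G : R).
Variables (f : nat -> 'rV[R]_d -> R) (g : nat -> 'rV[R]_d -> 'rV[R]_d).
Hypotheses (G0 : 0 <= G) (KA1 : A1 K Rad) (fA : A2_A4 K G f g).
Variable (O : nat -> R -> 'rV[R]_d -> 'rV[R]_d -> 'rV[R]_d * 'rV[R]_d).
Hypothesis O_IP : forall m eps x0 y0, 0 < eps -> K x0 ->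
    let: (x, yt) := O m eps x0 y0 in
    [/\ K x, enorm yt <= Rad, enorm (x - yt) <= Num.sqrt (3 * eps)
      & forall z, K z -> enorm (yt - z) <= enorm (y0 - z)].
Variables (s Kb : nat) (eta eps : R) (x1 : 'rV[R]_d).
Hypotheses (Kx1 : K x1) (eta0 : 0 < eta) (eps0 : 0 < eps) (Kb0 : (0 < Kb)%N).
Variable (u : nat -> 'rV[R]_d).
Hypothesis Ku : forall t, K (u t).

Let st m := bogd_state O g s eta Kb eps x1 m.
Let pred t := bogd_pred O g s eta Kb eps x1 t.
Let delta t := enorm (u t - u t.+1).

Lemma bogd_stateP m :
  [/\ K (st m).1, enorm (st m).2 <= Rad & enorm ((st m).1 - (st m).2) <= Num.sqrt (3 * eps)].
Proof.
have [_ _ _ bK] := KA1.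
elim: m => [|m [IH _ _]] /=; first by rewrite subrr enorm0 sqrtr_ge0 bK.
rewrite /st /=; move: IH; rewrite /st; case: (bogd_state _ _ _ _ _ _ _ m) => x y /= Kx.
by have := O_IP m eps x (y - eta *: \sum_(j < Kb) g (s + m * Kb + j)%N x) eps0 Kx;
  case: (O _ _ _ _) => x' y' [].
Qed.

Lemma bogd_pred_in t : K (pred t).
Proof. by have [] := bogd_stateP ((t - s) %/ Kb). Qed.

Lemma delta_ge0 t : 0 <= delta t. Proof. exact: enorm_ge0. Qed.

Lemma path_widen a b c : (b <= c)%N -> \sum_(a <= t < b) delta t <= \sum_(a <= t < c) delta t.
Proof.
move=> bc; have [ab|/ltnW ba] := leqP a b.
  by rewrite (big_cat_nat ab bc)/= lerDl sumr_ge0// => i _; exact: delta_ge0.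
by rewrite big_geq// sumr_ge0// => i _; exact: delta_ge0.
Qed.

(** The oracle brings its input no farther from any point of [K], which replaces nonexpansiveness of
    the projection in the usual gradient descent step. *)
Lemma bogd_step_dist m z : K z ->
  enorm ((st m.+1).2 - z) ^+ 2 <=
  enorm ((st m).2 - z) ^+ 2 -
  2 * eta * dotp (\sum_(j < Kb) g (s + m * Kb + j)%N (st m).1) ((st m).2 - z)
  + (eta * (Kb%:R * G)) ^+ 2.
Proof.
move=> Kz; set gs := \sum_(j < Kb) _.
have [Kx _ _] := bogd_stateP m.
have gsG : enorm gs <= Kb%:R * G.
  apply: le_trans (enorm_sum _ _ _ _) _.
  apply: le_trans (_ : \sum_(j < Kb) G <= _).
    by apply: ler_sum => j _; have [_ + _ _] := fA (s + m * Kb + j)%N; exact.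
  by rewrite sumr_const card_ord mulr_natl.
have h : enorm ((st m.+1).2 - z) <= enorm ((st m).2 - eta *: gs - z).
  move: Kx; rewrite /gs /st /=; case: (bogd_state _ _ _ _ _ _ _ m) => x y /= Kx.
  have := O_IP m eps x (y - eta *: \sum_(j < Kb) g (s + m * Kb + j)%N x) eps0 Kx.
  by case: (O _ _ _ _) => x' y' [_ _ _]; exact.
apply: le_trans (_ : enorm ((st m).2 - eta *: gs - z) ^+ 2 <= _).
  by rewrite lerXn2r ?nnegrE ?enorm_ge0.
have -> : (st m).2 - eta *: gs - z = ((st m).2 - z) - eta *: gs by rewrite addrAC.
rewrite enorm_sqrBZ lerD2l.
by rewrite lerXn2r ?nnegrE ?mulr_ge0 ?enorm_ge0 ?(ltW eta0)// ler_wpM2l ?(ltW eta0).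
Qed.

(** Within a block the comparator is frozen at the block start [a]. The vector [x - u (a + j)]
    splits into [x - y], paid by the oracle tolerance, [y - u a], paid by the descent step, and
    [u a - u (a + j)], paid by the path length of the block. *)
Lemma bogd_block m :
  \sum_(s + m * Kb <= t < s + m * Kb + Kb) (f t (st m).1 - f t (u t)) <=
  Kb%:R * (G * Num.sqrt (3 * eps) + eta / 2 * Kb%:R * G ^+ 2)
  + (enorm ((st m).2 - u (s + m * Kb)%N) ^+ 2
     - enorm ((st m.+1).2 - u (s + m * Kb)%N) ^+ 2) / (2 * eta)
  + Kb%:R * G * \sum_(s + m * Kb <= t < s + m * Kb + Kb) delta t.
Proof.
set a := (s + m * Kb)%N; have [Kx _ xy] := bogd_stateP m.
set x := (st m).1 in Kx xy *; set y := (st m).2 in xy *.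
have each (j : 'I_Kb) : f (a + j)%N x - f (a + j)%N (u (a + j)%N) <=
    G * Num.sqrt (3 * eps) + dotp (g (a + j)%N x) (y - u a)
    + G * \sum_(a <= t < a + Kb) delta t.
  have [_ gG cvx _] := fA (a + j)%N.
  have h := cvx _ _ Kx (Ku (a + j)%N).
  have gx := gG _ Kx.
  have h1 : dotp (g (a + j)%N x) (x - y) <= G * Num.sqrt (3 * eps).
    by apply: le_trans (dotp_le_enorm _ _) _; rewrite ler_pM ?enorm_ge0.
  have h2 : dotp (g (a + j)%N x) (u a - u (a + j)%N) <= G * \sum_(a <= t < a + Kb) delta t.
    apply: le_trans (dotp_le_enorm _ _) _; rewrite ler_pM ?enorm_ge0//.
    apply: le_trans (enorm_path_le _ _ _) _.
    by apply: path_widen; rewrite leq_add2l ltnW.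
  by move: h h1 h2; rewrite !dotpE; lra.
rewrite sum_nat_shift; apply: le_trans (ler_sum _ (fun j _ => each j)) _.
rewrite !big_split /= !sumr_const card_ord -dotp_suml.
have := bogd_step_dist m (u a) (Ku a); rewrite -/x -/y -/a /=.
set gs := \sum_(j < Kb) _; set p := enorm _ ^+ 2; set p' := enorm _ ^+ 2 => h.
have h3 : dotp gs (y - u a) <= (p' - p) / (2 * eta) + eta / 2 * (Kb%:R * G) ^+ 2.
  rewrite -(ler_pM2l (mulr_gt0 (ltr0n R 2) eta0)).
  have -> : 2 * eta * ((p' - p) / (2 * eta) + eta / 2 * (Kb%:R * G) ^+ 2) =
    p' - p + (eta * (Kb%:R * G)) ^+ 2 by field; rewrite gt_eqF.
  lra.
rewrite -(mulr_natl (G * Num.sqrt _)) -(mulr_natl (G * \sum_(_ <= _ < _) _)).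
by move: h3; rewrite exprMn; lra.
Qed.

Lemma bogd_pred_block m j : (j < Kb)%N -> pred (s + m * Kb + j) = (st m).1.
Proof.
by move=> jK; rewrite /pred /bogd_pred -addnA addKn divnMDl// divn_small// addn0.
Qed.

(** The negative squared distance stays in the bound as the telescoping term; each change of frozen
    comparator is charged to the path length. *)
Lemma bogd_blocks M :
  \sum_(s <= t < s + M * Kb) (f t (pred t) - f t (u t)) <=
  M%:R * (Kb%:R * (G * Num.sqrt (3 * eps) + eta / 2 * Kb%:R * G ^+ 2))
  + (4 * Rad ^+ 2 - enorm ((st M).2 - u (s + M * Kb)%N) ^+ 2) / (2 * eta)
  + (2 * Rad / eta + Kb%:R * G) * \sum_(s <= t < s + M * Kb) delta t.
Proof.
have [_ _ _ bK] := KA1.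
have dist m z : K z -> enorm ((st m).2 - z) <= 2 * Rad.
  move=> Kz; apply: le_trans (enormD _ _) _; rewrite enormN.
  by have [_ h _] := bogd_stateP m; have := bK _ Kz; lra.
elim: M => [|M IH].
  rewrite mul0n addn0 !big_geq// mulr0 mul0r add0r addr0 divr_ge0//; last first.
    by rewrite mulr_ge0// ltW.
  have := dist 0%N _ (Ku s); have := enorm_ge0 ((st 0%N).2 - u s).
  by move: (enorm _) => e; nra.
have l1 : (s <= s + M * Kb)%N by rewrite leq_addr.
have l2 : (s + M * Kb <= s + M.+1 * Kb)%N by rewrite leq_add2l leq_mul2r leqnSn orbT.
have e1 : (s + M.+1 * Kb = s + M * Kb + Kb)%N by rewrite mulSn addnCA addnC.
rewrite !(big_cat_nat l1 l2)/=.
have := bogd_block M.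
have -> : \sum_(s + M * Kb <= t < s + M * Kb + Kb) (f t (st M).1 - f t (u t)) =
          \sum_(s + M * Kb <= t < s + M.+1 * Kb) (f t (pred t) - f t (u t)).
  by rewrite e1 !sum_nat_shift; apply: eq_bigr => j _; rewrite bogd_pred_block.
rewrite e1; set a := (s + M * Kb)%N in IH *.
set D := \sum_(a <= t < a + Kb) delta t.
have D0 : 0 <= D by apply: sumr_ge0 => i _; exact: delta_ge0.
(* A difference of squares: the distances differ by at most [D] and each is at most [2 * Rad]. *)
have drift : enorm ((st M.+1).2 - u (a + Kb)%N) ^+ 2 - enorm ((st M.+1).2 - u a) ^+ 2
    <= 4 * Rad * D.
  have p2 := dist M.+1 _ (Ku a); have p2' := dist M.+1 _ (Ku (a + Kb)%N).
  have p3 : enorm ((st M.+1).2 - u (a + Kb)%N) <= enorm ((st M.+1).2 - u a) + D.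
    have -> : (st M.+1).2 - u (a + Kb)%N = (st M.+1).2 - u a + (u a - u (a + Kb)%N).
      by rewrite addrA subrK.
    by apply: le_trans (enormD _ _) _; rewrite lerD2l enorm_path_le.
  have := enorm_ge0 ((st M.+1).2 - u (a + Kb)%N); have := enorm_ge0 ((st M.+1).2 - u a).
  move: p2 p2' p3; move: (enorm _) (enorm _) => p q p2 q2 p3 q0 p0.
  have [pq|qp] := lerP p q; first by nra.
  by nra.
have i0 : 0 < (2 * eta)^-1 by rewrite invr_gt0 mulr_gt0.
have drift' := ler_wpM2r (ltW i0) drift.
have e2 : 4 * Rad * D / (2 * eta) = 2 * Rad / eta * D by field; rewrite gt_eqF.
move: drift' IH; rewrite e2 -[M.+1%:R]natr1.
by lra.
Qed.

Lemma bogd_regret L :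
  \sum_(s <= t < s + L) (f t (pred t) - f t (u t)) <=
  L%:R * (G * Num.sqrt (3 * eps) + eta / 2 * Kb%:R * G ^+ 2)
  + 2 * Rad ^+ 2 / eta + Kb%:R
  + (2 * Rad / eta + Kb%:R * G) * \sum_(s <= t < s + L) delta t.
Proof.
have Rad0 : 0 <= Rad by have [_ _ K0 bK] := KA1; exact: le_trans (enorm_ge0 _) (bK _ K0).
have MK : (L %/ Kb * Kb <= L)%N by rewrite leq_divM.
set M := (L %/ Kb)%N in MK.
have l1 : (s <= s + M * Kb)%N by rewrite leq_addr.
have l2 : (s + M * Kb <= s + L)%N by rewrite leq_add2l.
rewrite (big_cat_nat l1 l2)/=.
(* An incomplete last block is charged one unit per round, as losses lie in [0, 1]. *)
have tail : \sum_(s + M * Kb <= t < s + L) (f t (pred t) - f t (u t)) <= Kb%:R.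
  apply: le_trans (_ : \sum_(s + M * Kb <= t < s + L) 1 <= _).
    apply: ler_sum => t _; have [_ _ _ b] := fA t.
    have /andP[_ h1] := b _ (bogd_pred_in t); have /andP[h2 _] := b _ (Ku t).
    by rewrite /pred; lra.
  rewrite sumr_const_nat subnDl -[X in _ <= X%:R](subnKC (ltnW (ltn_pmod L Kb0))).
  by rewrite /M {1}(divn_eq L Kb) addKn ler_nat leq_addr.
have := bogd_blocks M.
set B := G * _ + _.
have B0 : 0 <= B by rewrite addr_ge0 ?mulr_ge0 ?sqrtr_ge0 ?sqr_ge0 ?invr_ge0 ?(ltW eta0).
have hB : M%:R * (Kb%:R * B) <= L%:R * B by rewrite mulrA -natrM ler_wpM2r// ler_nat.
have := path_widen s _ _ l2.
have c0 : 0 <= 2 * Rad / eta + Kb%:R * G.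
  by rewrite addr_ge0 ?mulr_ge0 ?invr_ge0 ?(ltW eta0).
move=> /(ler_wpM2l c0).
have := sqr_ge0 (enorm ((st M).2 - u (s + M * Kb)%N)).
move: (_ ^+ 2) => e e0.
have : (4 * Rad ^+ 2 - e) / (2 * eta) <= 2 * Rad ^+ 2 / eta.
  have -> : 2 * Rad ^+ 2 / eta = 4 * Rad ^+ 2 / (2 * eta) by field; rewrite gt_eqF.
  by rewrite ler_wpM2r ?invr_ge0 ?mulr_ge0 ?(ltW eta0)//; lra.
by lra.
Qed.

End Base.

(** * Interval lengths and algorithm parameters as powers of [qlev k] *)

Section Levels.
Context {R : realType}.

(* Fourth root of the interval length at level [k]: every power of [|I|]
   occurring in the algorithm is an integer power of it. *)
Definition qlev (k : nat) : R := (2 `^ (1 / 4)) ^+ k.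

Lemma qlev_expr4 k : qlev k ^+ 4 = (2 ^ k)%:R.
Proof.
rewrite -exprM mulnC exprM -(powR_mulrn 4 (powR_ge0 _ _)) -powRrM.
by rewrite (_ : 1 / 4 * 4%:R = 1) ?powRr1// ?natrX//; field.
Qed.

Lemma qlev_ge1 k : 1 <= qlev k.
Proof.
have : (1 : R) `^ (1 / 4) <= 2 `^ (1 / 4) by rewrite ge0_ler_powR ?nnegrE//; lra.
by rewrite powR1 => h; rewrite exprn_ege1.
Qed.

Lemma qlev_gt0 k : 0 < qlev k.
Proof. exact: lt_le_trans (qlev_ge1 k). Qed.

Lemma qlevS k : qlev k.+1 = qlev 1 * qlev k.
Proof. by rewrite /qlev exprS expr1. Qed.

(** The first bound pays for rounding the ideal interval length to a power of two; the second gives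
    the geometric growth behind [prefix_regret]. *)
Lemma qlev1_bounds : qlev 1 <= 2 /\ 3 / 2 <= qlev 1 ^+ 3.
Proof.
have q4 : qlev 1 ^+ 4 = 2 by rewrite qlev_expr4.
have q1 := qlev_ge1 1; move: (qlev 1) q4 q1 => q q4 q1.
split.
  have : q * 1 <= q * q ^+ 3 by rewrite ler_wpM2l ?exprn_ege1//; lra.
  by rewrite -exprS q4 mulr1.
have [//|h] := lerP (3 / 2) (q ^+ 3).
have e : (q ^+ 3) ^+ 4 = 8 by rewrite -exprM (_ : 3 * 4 = 4 * 3)%N// exprM q4; ring.
have : (q ^+ 3) ^+ 4 <= (3 / 2) ^+ 4.
  by rewrite lerXn2r ?nnegrE ?exprn_ge0//; lra.
by rewrite e; lra.
Qed.

Lemma sum_qlev_sqrV_le N : \sum_(k < N) (qlev k ^+ 2)^-1 <= 4.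
Proof.
have q4 : qlev 1 ^+ 4 = 2 by rewrite qlev_expr4.
(* A geometric series with ratio at most 3/4 is dominated by telescoping 4 times its terms. *)
suff : \sum_(k < N) (qlev k ^+ 2)^-1 <= 4 * (1 - (qlev N ^+ 2)^-1).
  have : 0 < (qlev N ^+ 2)^-1 by rewrite invr_gt0 exprn_gt0 ?qlev_gt0.
  lra.
elim: N => [|N IH]; first by rewrite big_ord0 /qlev expr0 expr1n invr1 subrr mulr0.
rewrite big_ord_recr /= qlevS exprMn invfM.
have h : (qlev 1 ^+ 2)^-1 <= 3 / 4.
  have y0 : 0 < qlev 1 ^+ 2 by rewrite exprn_gt0 ?qlev_gt0.
  have y2 : (qlev 1 ^+ 2) ^+ 2 = 2 by rewrite -exprM.
  by rewrite -div1r ler_pdivrMr//; nra.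
have p : 0 < (qlev N ^+ 2)^-1 by rewrite invr_gt0 exprn_gt0 ?qlev_gt0.
by have := ler_wpM2r (ltW p) h; lra.
Qed.

Lemma eta_ofE k : eta_of R (2 ^ k) = (qlev k ^+ 3)^-1.
Proof.
have q0 := ltW (qlev_gt0 k).
rewrite /eta_of -qlev_expr4 -powR_mulrn// -powRrM -powR_invn//.
by congr (_ `^ _); field.
Qed.

Lemma eps_ofE k : eps_of R (2 ^ k) = (qlev k ^+ 2)^-1.
Proof.
have q0 := ltW (qlev_gt0 k).
rewrite /eps_of eta_ofE -powR_invn// -powRrM -powR_invn//.
by congr (_ `^ _); field.
Qed.

(** [qlev k ^+ 2] is the square root of the interval length, irrational for odd [k], hence the
    integer part. *)
Lemma blk_ofE k : blk_of R (2 ^ k) = Num.truncn (qlev k ^+ 2).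
Proof.
have q0 := ltW (qlev_gt0 k).
rewrite /blk_of eta_ofE -powR_invn// -powRrM -powR_mulrn//.
by congr (Num.truncn (_ `^ _)); field.
Qed.

Lemma blk_of_gt0 k : (0 < blk_of R (2 ^ k))%N.
Proof. by rewrite blk_ofE truncn_gt0 exprn_ege1 ?qlev_ge1. Qed.

Lemma blk_of_le k : (blk_of R (2 ^ k))%:R <= qlev k ^+ 2.
Proof. by rewrite blk_ofE truncn_le// exprn_ge0 ?(ltW (qlev_gt0 k)). Qed.

End Levels.

(** Passes from one interval to a whole level: [T %/ n] intervals start in [n, T]. Prefixes of
    length [L] are covered because the horizon may cut the last one. *)
Lemma sum_intervals_le (R : realType) (F : nat -> R) (B : R) n T : (0 < n)%N ->
  (forall i L, (0 < i)%N -> (L <= n)%N -> \sum_(i * n <= t < i * n + L) F t <= B) ->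
  \sum_(n <= t < T.+1) F t <= (T %/ n)%:R * B.
Proof.
move=> n0 FB.
have full i : \sum_(n <= t < i.+1 * n) F t <= i%:R * B.
  elim: i => [|i IH]; first by rewrite mul1n big_geq// mul0r.
  have l1 : (n <= i.+1 * n)%N by rewrite leq_pmull.
  have l2 : (i.+1 * n <= i.+2 * n)%N by rewrite leq_mul2r leqnSn orbT.
  rewrite (big_cat_nat l1 l2)/= -natr1 mulrDl mul1r lerD//.
  by rewrite (mulSn i.+1) addnC FB.
have [Tn|nT] := ltnP T n; first by rewrite big_geq// divn_small// mul0r.
have i0 : (0 < T %/ n)%N by rewrite divn_gt0.
have e := divn_eq T n.
have l1 : (n <= T %/ n * n)%N by rewrite leq_pmull.
have l2 : (T %/ n * n <= T.+1)%N by rewrite ltnW// ltnS leq_divM.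
rewrite (big_cat_nat l1 l2)/= -(prednK i0) -natr1 mulrDl mul1r lerD//.
(* Round [T] is included, so the last piece has length [T %% n + 1], still at most [n]. *)
by rewrite (prednK i0) {2}e -addnS FB// ltn_mod.
Qed.

(** * Regret of the experts of one level *)

Section ExpertRegret.
Context {R : realType} {d : nat}.
Variables (K : set 'rV[R]_d) (Rad G : R).
Variables (f : nat -> 'rV[R]_d -> R) (g : nat -> 'rV[R]_d -> 'rV[R]_d).
Variables (O : oracle_type R d) (init : nat -> nat -> 'rV[R]_d).
Hypotheses (Rad0 : 0 < Rad) (G0 : 0 <= G) (KA1 : A1 K Rad) (fA : A2_A4 K G f g).
Hypotheses (O_IP : IP_oracle K Rad O) (Kinit : forall i k, K (init i k)).

Lemma eta_of_gt0 k : 0 < eta_of R (2 ^ k).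
Proof. by rewrite eta_ofE invr_gt0 exprn_gt0 ?qlev_gt0. Qed.

Lemma eps_of_gt0 k : 0 < eps_of R (2 ^ k).
Proof. by rewrite eps_ofE invr_gt0 exprn_gt0 ?qlev_gt0. Qed.

Lemma expert_pred_in t k : K (expert_pred O g init t k).
Proof.
apply: (bogd_pred_in K Rad g KA1 (O (t %/ 2 ^ k)%N k)) => //; last exact: eps_of_gt0.
by move=> *; exact: O_IP.
Qed.

Lemma expert_predE i k j : (j < 2 ^ k)%N ->
  expert_pred O g init (i * 2 ^ k + j) k =
  bogd_pred (O i k) g (i * 2 ^ k) (eta_of R (2 ^ k)) (blk_of R (2 ^ k))
    (eps_of R (2 ^ k)) (init i k) (i * 2 ^ k + j).
Proof.
move=> jn; rewrite /expert_pred /gc_start divnMDl ?expn_gt0//.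
by rewrite divn_small// addn0.
Qed.

Definition base_cst := 5 * G + G ^+ 2 + 2 * Rad ^+ 2 + 2 * Rad + 1.

(** With step [q ^- 3], block size at most [q ^+ 2], tolerance [q ^- 2] and length at most [q ^+ 4],
    every term of [bogd_regret] is [O(q ^+ 3)]. *)
Lemma expert_interval_regret (u : nat -> 'rV[R]_d) k i L : (forall t, K (u t)) ->
  (L <= 2 ^ k)%N ->
  \sum_(i * 2 ^ k <= t < i * 2 ^ k + L) (f t (expert_pred O g init t k) - f t (u t)) <=
  base_cst * qlev k ^+ 3 *
    (1 + \sum_(i * 2 ^ k <= t < i * 2 ^ k + L) enorm (u t - u t.+1)).
Proof.
move=> Ku Ln; have Gge0 := G0; have Rad_ge0 := ltW Rad0.
have := @bogd_regret R d K Rad G f g G0 KA1 fA (O i k) (O_IP i k) (i * 2 ^ k)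
  (blk_of R (2 ^ k)) (eta_of R (2 ^ k)) (eps_of R (2 ^ k)) (init i k) (Kinit i k)
  (eta_of_gt0 k) (eps_of_gt0 k) (blk_of_gt0 k) u Ku L.
rewrite (_ : \sum_(_ <= t < _) (f t (bogd_pred _ _ _ _ _ _ _ t) - _) =
   \sum_(i * 2 ^ k <= t < i * 2 ^ k + L) (f t (expert_pred O g init t k) - f t (u t)));
  last first.
  rewrite !sum_nat_shift; apply: eq_bigr => j _.
  by rewrite expert_predE// (leq_trans (ltn_ord j)).
move/le_trans; apply.
set D := \sum_(_ <= t < _) _.
have D0 : 0 <= D by apply: sumr_ge0 => t _; exact: enorm_ge0.
have Lq : L%:R <= qlev k ^+ 4 :> R by rewrite qlev_expr4 ler_nat.
have Bq := @blk_of_le R k; have q1 := @qlev_ge1 R k.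
rewrite eta_ofE eps_ofE /base_cst; set B := (blk_of R _)%:R in Bq *.
have B0 : 0 <= B by [].
move: (qlev k) Lq Bq q1 => q Lq Bq q1.
have q0 : 0 < q by lra.
have qN0 : q != 0 by rewrite gt_eqF.
have sq : Num.sqrt (3 * (q ^+ 2)^-1) <= 2 / q.
  rewrite -[leRHS]ger0_norm ?divr_ge0 ?(ltW q0)// -sqrtr_sqr ler_wsqrtr//.
  by rewrite expr_div_n ler_wpM2r ?invr_ge0 ?sqr_ge0//; lra.
have p1 : L%:R * (G * Num.sqrt (3 * (q ^+ 2)^-1) + (q ^+ 3)^-1 / 2 * B * G ^+ 2)
  <= q ^+ 3 * (2 * G + G ^+ 2).
  apply: le_trans (_ : q ^+ 4 * (G * (2 / q) + (q ^+ 3)^-1 / 2 * q ^+ 2 * G ^+ 2) <= _).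
    have i0 : 0 <= (q ^+ 3)^-1 / 2 by rewrite divr_ge0// invr_ge0 exprn_ge0// ltW.
    apply: ler_pM => //.
      by rewrite addr_ge0 ?mulr_ge0 ?sqrtr_ge0 ?sqr_ge0 ?invr_ge0 ?exprn_ge0 ?(ltW q0).
    by rewrite lerD ?ler_wpM2l ?ler_wpM2r ?sqr_ge0// ler_wpM2l.
  have -> : q ^+ 4 * (G * (2 / q) + (q ^+ 3)^-1 / 2 * q ^+ 2 * G ^+ 2) =
     q ^+ 3 * (2 * G + G ^+ 2 / 2) by field.
  rewrite ler_pM2l ?exprn_gt0//; have := sqr_ge0 G; lra.
have q3 : 0 < q ^+ 3 by rewrite exprn_gt0.
have Bq3 : B <= q ^+ 3.
  by apply: le_trans Bq _; rewrite [leRHS]exprS ler_peMl// exprn_ge0// ltW.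
have p4 : B * G <= q ^+ 3 * G by rewrite ler_wpM2r.
rewrite !invrK.
have p5 := ler_wpM2r D0 p4.
have p6 : 0 <= q ^+ 3 * D * (4 * G + G ^+ 2 + 2 * Rad ^+ 2 + 1).
  have := sqr_ge0 G; have := sqr_ge0 Rad => h1 h2.
  by apply: mulr_ge0; [rewrite mulr_ge0// ltW|lra].
have p7 : 0 <= q ^+ 3 * (3 * G + 2 * Rad) by rewrite mulr_ge0 ?(ltW q3)//; lra.
lra.
Qed.

Lemma level_expert_regret (u : nat -> 'rV[R]_d) k T : (forall t, K (u t)) ->
  \sum_(2 ^ k <= t < T.+1) (f t (expert_pred O g init t k) - f t (u t)) <=
  base_cst * (T%:R / qlev k + qlev k ^+ 3 * \sum_(2 ^ k <= t < T.+1) enorm (u t - u t.+1)).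
Proof.
move=> Ku.
have q0 := @qlev_gt0 R k.
have c0 : 0 <= base_cst by rewrite !addr_ge0 ?mulr_ge0 ?sqr_ge0 ?(ltW Rad0).
pose B := base_cst * qlev k ^+ 3.
have B0 : 0 <= B by rewrite mulr_ge0 ?exprn_ge0 ?(ltW q0).
(* The path term is moved into the summand, which leaves the same bound [B] for all intervals. *)
have := @sum_intervals_le R (fun t => f t (expert_pred O g init t k) - f t (u t) -
   B * enorm (u t - u t.+1)) B (2 ^ k) T.
rewrite expn_gt0 => /(_ isT); rewrite sumrB -mulr_sumr => h.
have : (T %/ 2 ^ k)%:R * B <= base_cst * (T%:R / qlev k).
  rewrite /B mulrCA ler_wpM2l// ler_pdivlMr// -mulrA -exprSr qlev_expr4 -natrM ler_nat.
  exact: leq_divM.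
suff : \sum_(2 ^ k <= t < T.+1) (f t (expert_pred O g init t k) - f t (u t)) -
      B * (\sum_(2 ^ k <= t < T.+1) enorm (u t - u t.+1)) <= (T %/ 2 ^ k)%:R * B.
  by rewrite /B; lra.
apply: h => i L i0 Ln; rewrite sumrB -mulr_sumr.
by have := expert_interval_regret u k i L Ku Ln; rewrite -/B; lra.
Qed.

End ExpertRegret.

Lemma sum_active_exchange (V : nmodType) (F : nat -> nat -> V) T :
  \sum_(1 <= t < T.+1) \sum_(k < t.+1 | active t k) F t k =
  \sum_(k < T.+1) \sum_(2 ^ k <= t < T.+1) F t k.
Proof.
elim: T => [|T IH].
  by rewrite big_geq// big_ord_recl big_ord0 big_geq// addr0.
rewrite big_nat_recr//= IH [RHS]big_ord_recr /=.
have hT : (T.+1 < 2 ^ T.+1)%N := @ltn_expl 2 T.+1 isT.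
rewrite [X in _ = _ + X](big_geq hT) addr0.
rewrite [X in _ + X]big_mkcond [X in _ + X]big_ord_recr /= /active [(_ <= _)%N]leqNgt hT addr0.
rewrite -big_split /=; apply: eq_bigr => k _.
case: leqP => h; first by rewrite [RHS]big_nat_recr.
by rewrite !big_geq ?addr0// ltnW.
Qed.

(** * Regret of the aggregation against the experts of one level *)

Section Meta.
Context {R : realType} {d : nat}.
Variables (K : set 'rV[R]_d) (Rad G : R).
Variables (f : nat -> 'rV[R]_d -> R) (g : nat -> 'rV[R]_d -> 'rV[R]_d).
Variables (O : oracle_type R d) (init : nat -> nat -> 'rV[R]_d).
Hypotheses (KA1 : A1 K Rad) (fA : A2_A4 K G f g).
Hypotheses (O_IP : IP_oracle K Rad O) (Kinit : forall i k, K (init i k)).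

Let xp t := pola_play O g init f t.
Let ep t k := expert_pred O g init t k.
Let r t k := f t (xp t) - f t (ep t k).
Let P t k := prevRC (RC O g init f t.-1) t k.
Let Q t k := RC O g init f t k.

Lemma RC_step t k : (0 < t)%N -> Q t k = ((P t k).1 + r t k, (P t k).2 + `|r t k|).
Proof. by case: t. Qed.

Lemma RC_bound t k : 0 <= (Q t k).2 /\ `|(Q t k).1| <= (Q t k).2.
Proof.
elim: t k => [|t IH] k; first by rewrite /Q /= normr0.
have [h1 h2] : 0 <= (P t.+1 k).2 /\ `|(P t.+1 k).1| <= (P t.+1 k).2.
  by rewrite /P /prevRC; case: ifP => _; [rewrite normr0|exact: IH].
rewrite RC_step//=; split; first by rewrite addr_ge0.
by apply: le_trans (ler_normD _ _) _; rewrite lerD2r.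
Qed.

Lemma prevRC_bound t k : 0 <= (P t k).2 /\ `|(P t k).1| <= (P t k).2.
Proof. by rewrite /P /prevRC; case: ifP => _; [rewrite normr0|exact: RC_bound]. Qed.

Lemma wgt_prev_ge0 t k : 0 <= wgt (P t k).1 (P t k).2.
Proof. by apply: wgt_ge0; have [] := prevRC_bound t k. Qed.

(** The level-0 expert is new in every round, so its weight is always [wgt 0 0]. *)
Lemma total_weight_gt0 t : (0 < t)%N ->
  0 < \sum_(k < t.+1 | active t k) wgt (P t k).1 (P t k).2.
Proof.
move=> t0; rewrite (bigD1 ord0)//= ltr_pwDl//; last first.
  by apply: sumr_ge0 => k _; exact: wgt_prev_ge0.
by rewrite /P /prevRC expn0 dvd1n; exact: wgt00_gt0.
Qed.

Lemma ep_in t k : K (ep t k).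
Proof. by apply: expert_pred_in KA1 O_IP Kinit _ _. Qed.

Lemma pola_play_in t : (0 < t)%N -> K (xp t).
Proof.
move=> t0; have [cK _ K0 _] := KA1; have Z0 := total_weight_gt0 t t0.
rewrite /xp /pola_play /play_from -/(P t).
set Z := \sum_(k < t.+1 | _) _ in Z0 *.
have [|k _|z Kz ->] := @convex_set_sum R d K _ (index_enum 'I_t.+1) (active t)
  (fun k => wgt (P t k).1 (P t k).2 / Z) (fun k => ep t k) cK K0.
- by move=> k _; rewrite divr_ge0 ?wgt_prev_ge0// ltW.
- exact: ep_in.
- by rewrite -mulr_suml divff ?gt_eqF// scale1r.
Qed.

(* The play is the weighted average of the experts, so this is convexity of
   the loss at the play. *)
Lemma weighted_regret_le0 t : (0 < t)%N ->
  \sum_(k < t.+1 | active t k) wgt (P t k).1 (P t k).2 * r t k <= 0.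
Proof.
move=> t0; have Z0 := total_weight_gt0 t t0; have Kx := pola_play_in t t0.
set Z := \sum_(k < t.+1 | _) _ in Z0 *.
have Zx : \sum_(k < t.+1 | active t k) wgt (P t k).1 (P t k).2 *: ep t k = Z *: xp t.
  rewrite /xp /pola_play /play_from -/(P t) scaler_sumr.
  apply: eq_bigr => k _; rewrite scalerA -/Z mulrCA divff ?mulr1// gt_eqF//.
have [_ _ cvx _] := fA t.
apply: le_trans (_ : \sum_(k < t.+1 | active t k)
   wgt (P t k).1 (P t k).2 * dotp (g t (xp t)) (xp t - ep t k) <= _).
  apply: ler_sum => k _; apply: ler_wpM2l; first exact: wgt_prev_ge0.
  have := cvx _ _ Kx (ep_in t k).
  by rewrite /r -[_ - ep t k]opprB [in X in _ -> X]dotpNr; lra.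
under eq_bigr => k _ do rewrite -dotpZr scalerBr.
rewrite -dotp_sumr sumrB -scaler_suml -/Z Zx subrr dotp0r.
exact: lexx.
Qed.

Lemma regret_le1 t k : (0 < t)%N -> `|r t k| <= 1.
Proof.
move=> t0; have [_ _ _ b] := fA t.
have /andP[h1 h2] := b _ (pola_play_in t t0); have /andP[h3 h4] := b _ (ep_in t k).
by rewrite ler_norml /r; apply/andP; split; lra.
Qed.

(** The growth is measured from the state after the reset: at an interval start it is relative to
    [Phi 0 0 = 1], and the final potential of the previous expert is never subtracted. *)
Let dPhi t k := Phi (Q t k).1 (Q t k).2 - Phi (P t k).1 (P t k).2.
Let gen t k := `|r t k| / ((P t k).2 + 1).

(** Summing [Phi_step] over the active experts, the linear terms add up to the nonpositive weighted
    regret. *)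
Lemma round_potential t : (0 < t)%N ->
  \sum_(k < t.+1 | active t k) dPhi t k <=
  expR 6 * \sum_(k < t.+1 | active t k) gen t k.
Proof.
move=> t0; have := weighted_regret_le0 t t0.
suff : \sum_(k < t.+1 | active t k) dPhi t k <=
  \sum_(k < t.+1 | active t k) (wgt (P t k).1 (P t k).2 * r t k + expR 6 * gen t k).
  by rewrite [leRHS]big_split /= -mulr_sumr; lra.
apply: ler_sum => k _; have [h1 h2] := prevRC_bound t k.
have := Phi_step _ _ _ h1 h2 (regret_le1 t k t0).
by rewrite /dPhi (RC_step t k t0) /= /gen; lra.
Qed.

Section Interval.
Variables (i k : nat).
Hypothesis i0 : (0 < i)%N.
Let s := (i * 2 ^ k)%N.

Lemma interval_start_gt0 : (0 < s)%N.
Proof. by rewrite muln_gt0 i0 expn_gt0. Qed.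

(** The inequality is strict because at [s + 2 ^ k] the state has already been reset for the next
    expert. *)
Lemma prevRC_interval L : (L < 2 ^ k)%N ->
  P (s + L) k = (\sum_(s <= t < s + L) r t k, \sum_(s <= t < s + L) `|r t k|).
Proof.
elim: L => [|L IH] Ln.
  by rewrite addn0 !big_geq// /P /prevRC dvdn_mull.
have /IH {}IH : (L < 2 ^ k)%N by exact: ltnW.
have -> : P (s + L.+1) k = Q (s + L) k.
  rewrite /P /prevRC dvdn_addr ?dvdn_mull// gtnNdvd//.
  by rewrite addnS.
rewrite RC_step ?addn_gt0 ?interval_start_gt0// IH /=.
by rewrite addnS !big_nat_recr ?leq_addr.
Qed.

Lemma RC_interval L : (L < 2 ^ k)%N ->
  Q (s + L) k = (\sum_(s <= t < s + L.+1) r t k, \sum_(s <= t < s + L.+1) `|r t k|).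
Proof.
move=> Ln; rewrite RC_step ?addn_gt0 ?interval_start_gt0// prevRC_interval//=.
by rewrite addnS !big_nat_recr ?leq_addr.
Qed.

Lemma dPhi_interval L : (L <= 2 ^ k)%N ->
  \sum_(s <= t < s + L) dPhi t k =
  Phi (\sum_(s <= t < s + L) r t k) (\sum_(s <= t < s + L) `|r t k|) - 1.
Proof.
elim: L => [|L IH] Ln; first by rewrite addn0 !big_geq// Phi_np// subrr.
rewrite addnS big_nat_recr ?leq_addr//= IH 1?ltnW//.
rewrite -addnS /dPhi RC_interval// prevRC_interval//=.
by rewrite addrC addrA subrK.
Qed.

Lemma abs_regret_interval L : \sum_(s <= t < s + L) `|r t k| <= L%:R.
Proof.
apply: le_trans (_ : \sum_(s <= t < s + L) 1 <= _); last by rewrite sumr_const_nat addKn.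
rewrite !sum_nat_shift; apply: ler_sum => j _.
by rewrite regret_le1// addn_gt0 interval_start_gt0.
Qed.

Lemma gen_interval L : (L <= 2 ^ k)%N ->
  \sum_(s <= t < s + L) gen t k <=
  3 * (Num.sqrt (\sum_(s <= t < s + L) `|r t k| + 1) - 1).
Proof.
elim: L => [|L IH] Ln; first by rewrite addn0 !big_geq// add0r sqrtr1 subrr mulr0.
rewrite addnS !big_nat_recr ?leq_addr//=.
have := IH (ltnW Ln); set c := \sum_(s <= t < s + L) `|r t k|.
have -> : gen (s + L)%N k = `|r (s + L)%N k| / (c + 1) by rewrite /gen prevRC_interval.
have c0 : 0 <= c by apply: sumr_ge0.
have s0 : (0 < s + L)%N by rewrite addn_gt0 interval_start_gt0.
have h : 0 <= `|r (s + L)%N k| <= 1 by rewrite normr_ge0 regret_le1.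
by have := div1D_le_sqrt _ _ c0 h; lra.
Qed.

Lemma regret_interval L : (L <= 2 ^ k)%N ->
  \sum_(s <= t < s + L) r t k <= qlev k ^+ 3 + 18 / qlev k * \sum_(s <= t < s + L) dPhi t k.
Proof.
move=> Ln; rewrite dPhi_interval//; apply: le_Phi_potential; first exact: qlev_gt0.
  rewrite sumr_ge0//= qlev_expr4; apply: le_trans (abs_regret_interval L) _.
  by rewrite ler_nat.
exact: ler_norm_sum.
Qed.

Lemma dPhi_interval_ge0 L : (L <= 2 ^ k)%N -> 0 <= \sum_(s <= t < s + L) dPhi t k.
Proof. by move=> Ln; rewrite dPhi_interval// subr_ge0 Phi_ge1// sumr_ge0. Qed.

Lemma gen_interval_le L : (L <= 2 ^ k)%N -> \sum_(s <= t < s + L) gen t k <= 6 * qlev k ^+ 2.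
Proof.
move=> Ln; apply: le_trans (gen_interval L Ln) _.
have q1 := @qlev_ge1 R k.
have q2 : 1 <= qlev k ^+ 2 :> R by rewrite exprn_ege1.
suff : Num.sqrt (\sum_(s <= t < s + L) `|r t k| + 1) <= 2 * qlev k ^+ 2 by lra.
rewrite -[leRHS]ger0_norm; last lra.
rewrite -sqrtr_sqr ler_wsqrtr//.
have : \sum_(s <= t < s + L) `|r t k| <= (qlev k ^+ 2) ^+ 2.
  rewrite -exprM qlev_expr4; apply: le_trans (abs_regret_interval L) _.
  by rewrite ler_nat.
by nra.
Qed.

End Interval.

Lemma level_dPhi_ge0 k T : 0 <= \sum_(2 ^ k <= t < T.+1) dPhi t k.
Proof.
have := @sum_intervals_le R (fun t => - dPhi t k) 0 (2 ^ k) T.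
rewrite expn_gt0 mulr0 sumrN oppr_le0 => /(_ isT); apply => i L i0 Ln.
by rewrite sumrN oppr_le0 dPhi_interval_ge0.
Qed.

Lemma level_gen_le k T : \sum_(2 ^ k <= t < T.+1) gen t k <= 6 * T%:R * (qlev k ^+ 2)^-1.
Proof.
have := @sum_intervals_le R (fun t => gen t k) (6 * qlev k ^+ 2) (2 ^ k) T.
rewrite expn_gt0 => /(_ isT (fun i L i0 Ln => gen_interval_le i k i0 L Ln)).
move/le_trans; apply; have q0 := @qlev_gt0 R k.
rewrite ler_pdivlMr ?exprn_gt0// -[leLHS]mulrA -mulrA -expr2 -exprM.
by rewrite mulrCA ler_wpM2l// qlev_expr4 -natrM ler_nat leq_divM.
Qed.

(** Growth is controlled only jointly over levels. One level is bounded by all of them, the sum is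
    taken round by round to apply [round_potential], then regrouped by level; the drift of level [j]
    is at most [6 * T / qlev j ^+ 2], and the geometric sum gives 6 * 4 = 24. *)
Lemma level_dPhi_le k T : (2 ^ k <= T)%N ->
  \sum_(2 ^ k <= t < T.+1) dPhi t k <= 24 * expR 6 * T%:R.
Proof.
move=> kT.
have kT1 : (k < T.+1)%N by rewrite ltnS ltnW// (leq_trans (ltn_expl k _) kT).
apply: le_trans (_ : \sum_(j < T.+1) \sum_(2 ^ j <= t < T.+1) dPhi t j <= _).
  rewrite (bigD1 (Ordinal kT1))//= lerDl sumr_ge0// => j _; exact: level_dPhi_ge0.
rewrite -sum_active_exchange.
apply: le_trans (_ : \sum_(1 <= t < T.+1) expR 6 *
    \sum_(j < t.+1 | active t j) gen t j <= _).
  by rewrite !big_nat; apply: ler_sum => t /andP[t0 _]; exact: round_potential.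
rewrite -mulr_sumr sum_active_exchange.
apply: le_trans (_ : expR 6 * \sum_(j < T.+1) 6 * T%:R * (qlev j ^+ 2)^-1 <= _).
  by rewrite ler_wpM2l ?expR_ge0//; apply: ler_sum => j _; exact: level_gen_le.
have e0 : 0 <= 6 * expR 6 * T%:R :> R by rewrite !mulr_ge0 ?expR_ge0.
by rewrite -mulr_sumr; have := ler_wpM2l e0 (sum_qlev_sqrV_le T.+1); lra.
Qed.

(** The terms [qlev k ^+ 3] of the [T %/ 2 ^ k] intervals total at most [T / qlev k]; the potential
    terms contribute 18 * 24 = 432 times [expR 6 * T / qlev k]. *)
Lemma level_meta_regret k T : (2 ^ k <= T)%N ->
  \sum_(2 ^ k <= t < T.+1) r t k <= (1 + 432 * expR 6) * (T%:R / qlev k).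
Proof.
move=> kT; have q0 := @qlev_gt0 R k.
have := @sum_intervals_le R (fun t => r t k - 18 / qlev k * dPhi t k) (qlev k ^+ 3) (2 ^ k) T.
rewrite expn_gt0 => /(_ isT); rewrite sumrB -mulr_sumr => h.
have i0 : 0 <= 18 / qlev k :> R by rewrite divr_ge0// ltW.
have := ler_wpM2l i0 (level_dPhi_le k T kT).
have : (T %/ 2 ^ k)%:R * qlev k ^+ 3 <= T%:R / qlev k :> R.
  by rewrite ler_pdivlMr// -mulrA -exprSr qlev_expr4 -natrM ler_nat leq_divM.
suff : \sum_(2 ^ k <= t < T.+1) r t k - 18 / qlev k * \sum_(2 ^ k <= t < T.+1) dPhi t k
   <= (T %/ 2 ^ k)%:R * qlev k ^+ 3 by lra.
apply: h => i L i1 Ln; rewrite sumrB -mulr_sumr.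
by have := regret_interval i k i1 L Ln; lra.
Qed.

End Meta.

(** * Combining the levels and choosing the best one *)

Section Regret.
Context {R : realType} {d : nat}.
Variables (K : set 'rV[R]_d) (Rad G : R).
Variables (f : nat -> 'rV[R]_d -> R) (g : nat -> 'rV[R]_d -> 'rV[R]_d).
Variables (O : oracle_type R d) (init : nat -> nat -> 'rV[R]_d).
Hypotheses (Rad0 : 0 < Rad) (G0 : 0 <= G) (KA1 : A1 K Rad) (fA : A2_A4 K G f g).
Hypotheses (O_IP : IP_oracle K Rad O) (Kinit : forall i k, K (init i k)).
Variable (u : nat -> 'rV[R]_d).
Hypothesis Ku : forall t, K (u t).

Let reg t := f t (pola_play O g init f t) - f t (u t).
Let delta t := enorm (u t - u t.+1).

Definition level_cst := 1 + 432 * expR 6 + base_cst Rad G.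

Lemma level_cst_ge1 : 1 <= level_cst.
Proof.
have Gge0 := G0; have Rge0 := ltW Rad0.
have := @expR_ge0 R 6; have := sqr_ge0 G; have := sqr_ge0 Rad.
by rewrite /level_cst /base_cst; lra.
Qed.

Lemma level_regret k T : (2 ^ k <= T)%N ->
  \sum_(2 ^ k <= t < T.+1) reg t <=
  level_cst * (T%:R / qlev k + qlev k ^+ 3 * \sum_(2 ^ k <= t < T.+1) delta t).
Proof.
move=> kT.
have := level_meta_regret _ _ _ _ _ _ _ KA1 fA O_IP Kinit k T kT.
have := level_expert_regret _ _ _ _ _ _ _ Rad0 G0 KA1 fA O_IP Kinit u k T Ku.
have -> : \sum_(2 ^ k <= t < T.+1) reg t =
  \sum_(2 ^ k <= t < T.+1) (f t (pola_play O g init f t) - f t (expert_pred O g init t k))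
  + \sum_(2 ^ k <= t < T.+1) (f t (expert_pred O g init t k) - f t (u t)).
  by rewrite -big_split /=; apply: eq_bigr => t _; rewrite addrA subrK.
have : 0 <= (1 + 432 * expR 6) * (qlev k ^+ 3 * \sum_(2 ^ k <= t < T.+1) delta t).
  have := @expR_ge0 R 6 => e0.
  apply: mulr_ge0; first lra.
  by rewrite mulr_ge0 ?exprn_ge0 ?(ltW (qlev_gt0 k))// sumr_ge0// => t _; exact: enorm_ge0.
by rewrite /level_cst; lra.
Qed.

(** Each dyadic range from [2 ^ k] to [2 ^ k.+1 - 1] is the first interval of level [k], so
    [level_regret] applies with the horizon at its end. *)
Lemma prefix_regret k :
  \sum_(1 <= t < 2 ^ k) reg t <=
  4 * level_cst * qlev k ^+ 3 * (1 + \sum_(1 <= t < 2 ^ k) delta t).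
Proof.
have c1 := level_cst_ge1.
elim: k => [|k IH].
  by rewrite !big_geq// /qlev !expr0 expr1n; lra.
have k0 : (0 < 2 ^ k)%N by rewrite expn_gt0.
have kS : (2 ^ k <= 2 ^ k.+1)%N by rewrite leq_exp2l.
rewrite !(big_cat_nat k0 kS)/=.
have e : ((2 ^ k.+1).-1.+1 = 2 ^ k.+1)%N by rewrite prednK// expn_gt0.
have kT : (2 ^ k <= (2 ^ k.+1).-1)%N by rewrite -ltnS e ltn_exp2l.
have := level_regret k _ kT; rewrite e.
have q0 := @qlev_gt0 R k.
have : (2 ^ k.+1).-1%:R / qlev k <= 2 * qlev k ^+ 3 :> R.
  rewrite ler_pdivrMr// -mulrA -exprSr qlev_expr4 -natrM ler_nat -expnS.
  exact: leq_pred.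
rewrite qlevS exprMn.
have [_] := @qlev1_bounds R.
have q3 : 0 < qlev k ^+ 3 :> R by rewrite exprn_gt0.
have : 0 <= \sum_(2 ^ k <= t < 2 ^ k.+1) delta t by apply: sumr_ge0 => t _; exact: enorm_ge0.
have : 0 <= \sum_(1 <= t < 2 ^ k) delta t by apply: sumr_ge0 => t _; exact: enorm_ge0.
move: IH q3; move: (qlev k ^+ 3) (qlev 1 ^+ 3) => q z.
move: (\sum_(1 <= t < 2 ^ k) reg t) (\sum_(2 ^ k <= t < _) reg t) => A B.
move: (\sum_(1 <= t < 2 ^ k) delta t) (\sum_(2 ^ k <= t < _) delta t) => D E.
move: ((2 ^ k.+1).-1%:R / _) level_cst c1 => y c c1 IH q0' D0 E0 z32 yq hB.
have c0 : 0 < c by lra.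
have cq : 0 < c * q by rewrite mulr_gt0.
have h1 : c * y <= 2 * (c * q) by have := ler_wpM2l (ltW c0) yq; lra.
have s0 : 0 <= 1 + (D + E) by lra.
(* Growth by 3/2 per level raises [4 * c * q] by at least [2 * c * q], the path-free cost of the new
   range; hence the factor 4. *)
have := ler_wpM2r (mulr_ge0 (ltW cq) s0) z32.
have : 0 <= c * q * D by rewrite mulr_ge0// ltW.
have : 0 <= c * q * E by rewrite mulr_ge0// ltW.
lra.
Qed.

Lemma regret_at_level k T : (2 ^ k <= T)%N ->
  \sum_(1 <= t < T.+1) reg t <=
  4 * level_cst * (T%:R / qlev k + qlev k ^+ 3 * (1 + \sum_(1 <= t < T.+1) delta t)).
Proof.
move=> kT; have c1 := level_cst_ge1.
have k0 : (0 < 2 ^ k)%N by rewrite expn_gt0.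
rewrite !(big_cat_nat k0 (leqW kT))/=.
have := prefix_regret k; have := level_regret k T kT.
have q0 := @qlev_gt0 R k.
have c0 : 0 <= level_cst by lra.
have : 0 <= level_cst * (T%:R / qlev k) by rewrite mulr_ge0// divr_ge0// ltW.
have : 0 <= level_cst * (qlev k ^+ 3 * \sum_(2 ^ k <= t < T.+1) delta t).
  rewrite !mulr_ge0 ?exprn_ge0 ?(ltW q0)// sumr_ge0// => t _; exact: enorm_ge0.
lra.
Qed.

Lemma pola_regret T : (0 < T)%N ->
  \sum_(1 <= t < T.+1) reg t <=
  16 * level_cst * (T%:R `^ (3 / 4) * (1 + \sum_(1 <= t < T.+1) delta t) `^ (1 / 4)).
Proof.
move=> T0; have c1 := level_cst_ge1.
set D := \sum_(1 <= t < T.+1) delta t.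
have D0 : 0 <= D by apply: sumr_ge0 => t _; exact: enorm_ge0.
have T1 : 1 <= T%:R :> R by rewrite ler1n.
have Tsplit : T%:R = T%:R `^ (3 / 4) * T%:R `^ (1 / 4) :> R.
  rewrite -powRD; first by rewrite -{1}(powRr1 (ler0n R T)); congr (_ `^ _); lra.
  by apply/implyP => _; rewrite gt_eqF//; lra.
have p0 : 0 <= T%:R `^ (3 / 4) :> R by exact: powR_ge0.
(* If [1 + D] exceeds [T], the claimed bound is at least [T], which bounds the regret trivially. *)
have [DT|TD] := lerP (1 + D) T%:R; last first.
  apply: le_trans (_ : 1 * T%:R <= _).
    rewrite mul1r; apply: le_trans (_ : \sum_(1 <= t < T.+1) 1 <= _); last first.
      by rewrite sumr_const_nat subSS subn0.
    rewrite !big_nat; apply: ler_sum => t /andP[t0 _]; have [_ _ _ b] := fA t.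
    have /andP[_ h1] := b _ (pola_play_in _ _ f g _ _ KA1 O_IP Kinit t t0).
    have /andP[h2 _] := b _ (Ku t).
    by rewrite /reg; lra.
  apply: ler_pM => //; first lra.
  rewrite {1}Tsplit ler_wpM2l// ge0_ler_powR ?nnegrE//; lra.
have D1 : 0 < 1 + D by lra.
(* The ideal interval length; [k] is the level of the largest power of two not exceeding it. *)
set y := T%:R / (1 + D).
have y1 : 1 <= y by rewrite ler_pdivlMr// mul1r.
have y0 : 0 < y by lra.
have N0 : (0 < Num.truncn y)%N by rewrite truncn_gt0.
have /andP[kN Nk] := trunc_log_bounds (ltnSn 1) N0.
set k := trunc_log 2 _ in kN Nk.
have ky : qlev k ^+ 4 <= y.
  by rewrite qlev_expr4; apply: le_trans (_ : (Num.truncn y)%:R <= _);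
     rewrite ?ler_nat// truncn_le// ltW.
have yk : y <= qlev k.+1 ^+ 4.
  rewrite qlev_expr4; apply: le_trans (ltW (truncnS_gt y)) _.
  by rewrite ler_nat.
have q0 := @qlev_gt0 R k.
have kT : (2 ^ k <= T)%N.
  rewrite -(ler_nat R) -qlev_expr4; apply: le_trans ky _.
  by rewrite ler_pdivrMr// ler_peMr//; lra.
apply: le_trans (regret_at_level k T kT) _; rewrite -/D.
(* As [qlev k ^+ 4 <= y], the path term is dominated by [T / qlev k]; [h2] bounds the latter, and
   the factors 4, 2 and 2 give 16. *)
have h1 : qlev k ^+ 3 * (1 + D) <= T%:R / qlev k.
  by rewrite ler_pdivlMr// mulrAC -exprSr -ler_pdivlMr.
have y4 : y `^ (1 / 4) <= 2 * qlev k.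
  apply: le_trans (_ : (qlev k.+1 ^+ 4) `^ (1 / 4) <= _).
    by rewrite ge0_ler_powR ?nnegrE ?exprn_ge0 ?(ltW (qlev_gt0 _))// ?(ltW y0)//; lra.
  rewrite -powR_mulrn ?(ltW (qlev_gt0 _))// -powRrM (_ : 4%:R * (1 / 4) = 1); last by field.
  rewrite powRr1 ?(ltW (qlev_gt0 _))// qlevS ler_wpM2r ?(ltW q0)//.
  by have [] := @qlev1_bounds R.
have h2 : T%:R / qlev k <= 2 * (T%:R `^ (3 / 4) * (1 + D) `^ (1 / 4)).
  have e : T%:R `^ (1 / 4) = y `^ (1 / 4) * (1 + D) `^ (1 / 4).
    by rewrite -powRM ?(ltW y0) ?(ltW D1)// divfK// gt_eqF.
  rewrite ler_pdivrMr// {1}Tsplit e mulrCA mulrC.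
  rewrite -mulrA mulrCA -!mulrA mulrCA.
  have w0 : 0 <= T%:R `^ (3 / 4) * (1 + D) `^ (1 / 4) by rewrite mulr_ge0 ?powR_ge0.
  by have := ler_wpM2l w0 y4; lra.
have c0 : 0 <= 4 * level_cst by lra.
have := ler_wpM2l c0 h1; have := ler_wpM2l c0 h2; lra.
Qed.

End Regret.

Theorem theorem4 (R : realType) (Rad G : R) :
  0 < Rad -> 0 <= G ->
  exists Cst : R, forall (d : nat) (K : set 'rV[R]_d)
    (O : oracle_type R d) (init : nat -> nat -> 'rV[R]_d)
    (f : nat -> 'rV[R]_d -> R) (g : nat -> 'rV[R]_d -> 'rV[R]_d)
    (T : nat) (u : nat -> 'rV[R]_d),
    A1 K Rad -> A2_A4 K G f g -> IP_oracle K Rad O ->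
    (forall i k, K (init i k)) ->
    (1 <= T)%N -> (forall t, (1 <= t <= T)%N -> K (u t)) ->
    \sum_(1 <= t < T.+1) f t (pola_play O g init f t) - \sum_(1 <= t < T.+1) f t (u t)
      <= Cst * ((T%:R) `^ (3 / 4) * (1 + path_length u T) `^ (1 / 4)).
Proof.
move=> Rad0 G0; exists (16 * level_cst Rad G) => d K O init f g T u KA1 fA O_IP Kinit T0 Ku.
(* The comparator is extended constantly outside 1..T: it then lies in [K] at every index, and the
   extra path term from [T] to [T.+1] vanishes. *)
pose v t := u (maxn 1 (minn t T)).
have vE t : (1 <= t <= T)%N -> v t = u t.
  by move=> /andP[t1 tT]; rewrite /v (minn_idPl tT) (maxn_idPr t1).
have Kv t : K (v t) by apply: Ku; rewrite leq_maxl geq_max T0 geq_minr.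
have := pola_regret _ _ _ _ _ _ _ Rad0 G0 KA1 fA O_IP Kinit v Kv T T0.
rewrite sumrB.
have -> : \sum_(1 <= t < T.+1) f t (v t) = \sum_(1 <= t < T.+1) f t (u t).
  by apply: eq_big_nat => t tT; rewrite vE.
suff -> : \sum_(1 <= t < T.+1) enorm (v t - v t.+1) = path_length u T by [].
rewrite /path_length [RHS]big_add1 /= big_nat_recr//=.
have -> : v T.+1 = v T by rewrite /v minnn (minn_idPr (leqnSn T)).
rewrite subrr enorm0 addr0; apply: eq_big_nat => t /andP[t1 tT].
by rewrite !vE ?tT ?t1 ?(ltnW tT).
Qed.
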